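(* For every $\varepsilon>0$, there exists a constant $C=C(\varepsilon)$ such that the following holds. Every $(n,d,\lambda)$-graph with $d/\lambda>C$ contains at least $(1-\varepsilon)\frac{d}{\ln d}$ pairwise (vertex-)disjoint connected dominating sets.
   Context: Graphs are finite and simple. An $n$-vertex graph $G$ whose adjacency matrix has eigenvalues $\lambda_1\geq \lambda_2\geq \ldots\geq \lambda_n$ is an $(n,d,\lambda)$-graph if it is $d$-regular and satisfies $\max\{\lambda_2,|\lambda_n|\}\leq \lambda$. A connected dominating set in a graph $G$ is a set $S\subseteq V(G)$ that is dominating (every vertex of $G$ is either in $S$ or adjacent to a vertex of $S$) and such that the induced subgraph $G[S]$ is connected. *)

(* Defs.v *)
From mathcomp Require Import all_boot all_order all_algebra.
From mathcomp Require Import reals exp.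

Set Implicit Arguments.
Unset Strict Implicit.
Unset Printing Implicit Defensive.

Import Order.TTheory GRing.Theory Num.Theory.
Local Open Scope ring_scope.

Definition simple_graph (T : finType) (e : rel T) : Prop :=
  symmetric e /\ irreflexive e.

Definition regular (T : finType) (e : rel T) (d : nat) : Prop :=
  forall x : T, #|[set y | e x y]| = d.

Definition adjmx (R : realType) (T : finType) (e : rel T) : 'M[R]_#|T| :=
  \matrix_(i, j) (e (enum_val i) (enum_val j))%:R.

(* s lists all eigenvalues of A, with algebraic multiplicity, in nonincreasing
   order: s`_0 >= s`_1 >= ... >= s`_n.-1. *)
Definition eigenvalue_list (R : realType) (n : nat) (A : 'M[R]_n)
    (s : n.-tuple R) : Prop :=
  sorted >=%R s /\ char_poly A = \prod_(x <- s) ('X - x%:P).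

(* Indices start at 0: s`_1 is lambda_2 and s`_n.-1 is lambda_n. For n = 1
   there is no lambda_2; then s`_1 = 0 <= `|s`_0|, so it plays no role. *)
Definition ndl_graph (R : realType) (n d : nat) (lambda : R)
    (T : finType) (e : rel T) : Prop :=
  [/\ simple_graph e,
      (0 < n)%N,
      #|T| = n,
      regular e d &
      exists s : #|T|.-tuple R,
        eigenvalue_list (adjmx R e) s /\
        Num.max s`_1 `|s`_n.-1| <= lambda].

Definition dominating (T : finType) (e : rel T) (S : {set T}) : Prop :=
  forall x : T, x \in S \/ exists2 y, y \in S & e x y.

(* The induced subgraph on S is connected. The empty set qualifies, but it
   dominates no graph with at least one vertex. *)
Definition connected_set (T : finType) (e : rel T) (S : {set T}) : Prop :=
  {in S &, forall x y, connect [rel u v in S | e u v] x y}.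

Definition connected_dominating (T : finType) (e : rel T) (S : {set T}) : Prop :=
  dominating e S /\ connected_set e S.

(* Main.v *)
(* Colour the vertices at random with about d / ln d colours, a few of which are kept as a reserve.
   A vertex misses a given colour in its neighbourhood with probability d^(-1 - c eps), which is too
   large for the local lemma. However, the set L(u) of the colours that are missing at some
   neighbour of u has fewer than d^(1 - c eps) elements with overwhelming probability, by an
   exponential moment bound. Hence one application of the local lemma makes all the L(u) small, and
   a second one, in which each vertex u of one half of the reserve picks a colour from L(u), repairs
   all defects. Every vertex then has at least c ln d neighbours in each of the classes D_i, and
   rho d neighbours in the other half R of the reserve.

   The components of a class D_i thus have at least c ln d vertices. They are merged one at a time
   by paths inside R. These paths are found in D-ary forests satisfying the condition of Friedman
   and Pippenger, which the expander mixing lemma provides as long as only a small proportion of R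
   is in use. Each vertex of R sees D_i, so that when s components are left, the neighbourhoods
   seeing only one given component are disjoint, and one of them has at most n / s vertices: a tree
   of depth log_D (n / s) leaves it. Summing over s and i, the paths use about
   (n / (c ln d)) log_D d = n / (c ln D) vertices, which is a small proportion of R for D large. *)

Require Import Defs.
From mathcomp Require Import all_boot all_order all_algebra.
From mathcomp Require Import reals sequences exp complex.
From mathcomp Require Import zify ring lra.

Set Implicit Arguments.
Unset Strict Implicit.
Unset Printing Implicit Defensive.

(** * The local lemma *)

Section LocalLemma.
Variables V A T : finType.
Implicit Types (f g : {ffun V -> A}) (S : {set V}) (E F : {set {ffun V -> A}}).

Definition depends_on S E :=
  forall f g, {in S, f =1 g} -> (f \in E) = (g \in E).

(** Exchanging the values outside [S] between two functions is an involution on pairs. It matches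
    the pairs whose first member is in [E :&: F] with the pairs in [E] times [F]; this is
    independence of events on disjoint coordinates, in counted form. *)
Lemma card_indep S S' E F :
  depends_on S E -> depends_on S' F -> [disjoint S & S'] ->
  #|E :&: F| * #|{: {ffun V -> A}}| = #|E| * #|F|.
Proof.
move=> hE hF dis; pose mix f g := [ffun v => if v \in S then f v else g v].
pose swap (p : {ffun V -> A} * {ffun V -> A}) := (mix p.1 p.2, mix p.2 p.1).
have swapK : involutive swap.
  move=> [f g]; rewrite /swap /=; congr (_, _); apply/ffunP => v; rewrite !ffunE;
  by case: (v \in S).
have inE1 f g : (mix f g \in E) = (f \in E).
  by apply: hE => v vS; rewrite ffunE vS.
have inF1 f g : (mix f g \in F) = (g \in F).
  apply: hF => v vS; rewrite ffunE; case: ifP => // /(disjointFr dis).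
  by rewrite vS.
rewrite -cardsT -!cardsX -(card_imset _ (inv_inj swapK)); congr #|pred_of_set _|.
apply/setP => -[f g]; rewrite -{1}[(f, g)]swapK mem_imset; last exact: inv_inj.
by rewrite !inE /= !andbT inE1 inF1.
Qed.

Variables (B : T -> {set {ffun V -> A}}) (S : T -> {set V}) (D : nat).
Hypothesis dep : forall t, depends_on (S t) (B t).
Hypothesis D_gt0 : 0 < D.
Hypothesis small : forall t, #|B t| * (4 * D) <= #|{: {ffun V -> A}}|.
Hypothesis degree : forall t, #|[set u | ~~ [disjoint S t & S u]]| <= D.

Let avoid (X : {set T}) : {set {ffun V -> A}} := \bigcap_(t in X) ~: B t.

(** [B t] is independent of the events in [X2], so it fills at most [1 / (4 * D)] of [avoid X2]. By
    induction the at most [D] events in [X1] cover at most half of [avoid X2], which at worst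
    doubles that proportion. *)
Lemma local_lemma_step X t : #|B t :&: avoid X| * (2 * D) <= #|avoid X|.
Proof.
have [n] := ubnP #|X|; elim: n X t => // n IHn X t; rewrite ltnS => leXn.
set X1 := X :&: [set u | ~~ [disjoint S t & S u]]; set X2 := X :\: X1.
have dep2 : depends_on (\bigcup_(u in X2) S u) (avoid X2).
  move=> f g fg; apply/bigcapP/bigcapP => h u uX; have := h u uX; rewrite !inE;
    rewrite (@dep u f g) // => v vS; apply: fg; apply/bigcupP; by exists u.
have dis2 : [disjoint S t & \bigcup_(u in X2) S u].
  apply/bigcup_disjointP => u; rewrite !inE negb_and negbK.
  by case/andP => /orP[/negbTE-> | ->].
have step2 : #|B t :&: avoid X2| * (4 * D) <= #|avoid X2|.
  have O0 : 0 < #|{: {ffun V -> A}}| \/ #|avoid X2| = 0.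
    case: (posnP #|avoid X2|) => [|p]; [by right | left].
    by apply: leq_trans p (max_card _).
  case: O0 => [O0|O0]; last first.
    have : #|B t :&: avoid X2| <= 0 by rewrite -O0 subset_leq_card // subsetIr.
    by rewrite leqn0 => /eqP->.
  have := card_indep (@dep t) dep2 dis2; move: (small t); nia.
have sub2 : avoid X \subset avoid X2.
  by apply/subsetP => f /bigcapP h; apply/bigcapP => u /setDP[uX _]; exact: h.
(* The induction applies to [X2] only when [X1] is nonempty; otherwise [X2] is [X] itself. *)
have [X10|X1n0] := posnP #|X1|.
  have -> : X = X2 by rewrite /X2 (cards0_eq X10) setD0.
  by apply: leq_trans step2; rewrite leq_mul2l leq_mul2r orbT orbT.
have split2 : #|avoid X2| <= #|avoid X| + \sum_(u in X1) #|B u :&: avoid X2|.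
  have : avoid X2 \subset avoid X :|: \bigcup_(u in X1) (B u :&: avoid X2).
    apply/subsetP => f f2; rewrite inE; case: (boolP (f \in avoid X)) => //= fX.
    apply/bigcupP; have /exists_inP[u uX fu] : [exists u in X, f \in B u].
      apply: contraR fX; rewrite negb_exists_in => /forall_inP h.
      by apply/bigcapP => u uX; rewrite inE h.
    exists u; last by rewrite inE fu.
    apply: contraLR fu => nu; have := bigcapP f2 u; rewrite in_setD nu uX in_setC.
    by apply.
  move/subset_leq_card/leq_trans; apply.
  apply: leq_trans (leq_card_setU _ _) _; rewrite leq_add2l.
  elim/big_ind2: _ => [|a b c d ab cd|u uX]; rewrite ?cards0 //.
  by apply: leq_trans (leq_card_setU _ _) (leq_add ab cd).
have ltX2 : #|X2| < n.
  apply: leq_trans leXn; rewrite cardsD (setIidPr _) ?subsetIl //.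
  have : #|X1| <= #|X| by rewrite subset_leq_card // subsetIl.
  lia.
have sum1 : (\sum_(u in X1) #|B u :&: avoid X2|) * (2 * D) <= #|X1| * #|avoid X2|.
  rewrite big_distrl /= -sum_nat_const; apply: leq_sum => u _; exact: IHn.
have X1D : #|X1| <= D.
  by apply: leq_trans (degree t); rewrite subset_leq_card // subsetIr.
have b12 : #|B t :&: avoid X| <= #|B t :&: avoid X2|.
  by rewrite subset_leq_card // setIS.
move: step2 split2 sum1 X1D b12.
set a := \sum_(u in X1) _; move: a #|avoid X| #|avoid X2| #|X1| #|B t :&: avoid X| #|B t :&: avoid X2|.
move=> a x x2 x1 b b2 h1 h2 h3 h4 h5.
have h6 : a * 2 <= x2.
  have : a * 2 * D <= x2 * D by apply: leq_trans (_ : x1 * x2 <= _); nia.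
  by rewrite leq_pmul2r.
by nia.
Qed.

(** Events are excluded one after another, and each time at least half of the remaining functions
    survive. The given function ensures that there is one to start from. *)
Theorem local_lemma : {ffun V -> A} -> exists f, forall t, f \notin B t.
Proof.
move=> f0; suff pos X : 0 < #|avoid X|.
  have /card_gt0P[f /bigcapP hf] := pos [set: T]; exists f => t.
  by have := hf t (in_setT t); rewrite inE.
have [n] := ubnP #|X|; elim: n X => // n IHn X; rewrite ltnS => leXn.
have [->|[t tX]] := set_0Vmem X.
  by apply/card_gt0P; exists f0; apply/bigcapP => t; rewrite inE.
have lt1 : #|X :\ t| < n by move: leXn; rewrite (cardsD1 t X) tX.
have := IHn _ lt1; have := local_lemma_step (X :\ t) t.
have -> : avoid X = avoid (X :\ t) :\: B t.
  by rewrite /avoid (big_setD1 t) //= [RHS]setDE [RHS]setIC.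
rewrite cardsD setIC; nia.
Qed.
End LocalLemma.

(** * Extendable forests *)

Section Forests.
Variables (V : finType) (e : rel V) (R : {set V}) (D m W : nat).
Implicit Types (p q : {ffun V -> option V}) (X Y L : {set V}).

Definition nbrs_in (X : {set V}) : {set V} := [set r in R | [exists x in X, e x r]].

(** A forest is encoded by its parent map: [p r = Some x] makes [r] a child of [x], and [None] marks
    roots and free vertices. *)
Definition dom p : {set V} := [set r | p r != None].
Definition children p x : {set V} := [set r | p r == Some x].
Definition valid p := forall r x, p r = Some x -> r \in R /\ e x r.

(* The Friedman-Pippenger condition. The children of X count towards the D|X| vertices that X has
   to reach, so that discarding a branch of the forest never breaks the condition. *)
Definition reach p X : {set V} :=
  [set r in R | if p r is Some x then x \in X else [exists x in X, e x r]].

Definition extendable p :=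
  valid p /\ forall X, #|X| <= 2 * m -> D * #|X| <= #|reach p X|.

Definition subforest p q := forall r, p r != None -> q r = p r.

Lemma subforest_trans p q s : subforest p q -> subforest q s -> subforest p s.
Proof. by move=> pq qs r pr; rewrite qs ?pq. Qed.

(** A vertex detached from its parent [x] is still a neighbour of [x] in [R], so [reach] can only
    grow. *)
Lemma extendable_sub p q : subforest p q -> extendable q -> extendable p.
Proof.
move=> sub [vq gq]; have vp : valid p.
  by move=> r x pr; apply: vq; rewrite sub pr.
split=> // X /gq /leq_trans; apply; apply: subset_leq_card.
apply/subsetP => r; rewrite !inE => /andP[rR]; rewrite rR /=.
case pr : (p r) => [x|]; first by rewrite sub pr.
case qr : (q r) => [x|] // xX; have [_ xr] := vq _ _ qr.
by apply/exists_inP; exists x.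
Qed.

Definition attach p r v := [ffun y => if y == r then Some v else p y].

Hypothesis m_gt0 : 0 < m.
Hypothesis expand : forall X, m < #|X| <= 2 * m -> W + D * #|X| < #|nbrs_in X|.

Definition tight p X := (#|X| <= 2 * m) && (#|reach p X| == D * #|X|).

Lemma reachU p X Y : reach p (X :|: Y) = reach p X :|: reach p Y.
Proof.
apply/setP => r; rewrite !inE -andb_orr; case: (r \in R) => //=.
case: (p r) => [x|]; first by rewrite inE.
apply/exists_inP/orP => [[x]|[]/exists_inP[x xX xr]]; last 2 first.
- by exists x; rewrite // inE xX.
- by exists x; rewrite // inE xX orbT.
by rewrite inE => /orP[]xX xr; [left|right]; apply/exists_inP; exists x.
Qed.

Lemma reachI p X Y : reach p (X :&: Y) \subset reach p X :&: reach p Y.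
Proof.
apply/subsetP => r; rewrite !inE => /andP[->] /=.
case: (p r) => [x|]; first by rewrite inE.
by move/exists_inP => [x]; rewrite inE => /andP[xX xY] xr; apply/andP; split;
  apply/exists_inP; exists x.
Qed.

(** Every neighbour of [X] in [R] is reached by [X] or is one of the at most [W] occupied vertices.
    By [expand], a set with more than [m] and at most [2 * m] members therefore reaches more than
    [D * #|X|] vertices. *)
Lemma tight_small p X : #|dom p| <= W -> tight p X -> #|X| <= m.
Proof.
move=> domW /andP[X2 /eqP tX]; rewrite leqNgt; apply/negP => Xm.
have := expand (X := X); rewrite Xm X2 => /(_ isT).
have : #|nbrs_in X| <= #|dom p| + #|reach p X|.
  have : nbrs_in X \subset dom p :|: reach p X.
    apply/subsetP => r; rewrite !inE => /andP[-> ex].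
    by case: (p r).
  by move/subset_leq_card/leq_trans; apply; exact: leq_card_setU.
lia.
Qed.

(** Submodularity: [reach] commutes with unions and maps an intersection into the intersection. Both
    sets have at most [m] members, so the lower bound on [reach] applies to their union and
    intersection and forces equality. *)
Lemma tightU p X Y : extendable p -> #|dom p| <= W ->
  tight p X -> tight p Y -> tight p (X :|: Y).
Proof.
move=> [_ gp] domW tX tY.
have Xm := tight_small domW tX; have Ym := tight_small domW tY.
have XY2 : #|X :|: Y| <= 2 * m.
  by apply: leq_trans (leq_card_setU _ _) _; rewrite mul2n -addnn leq_add.
rewrite /tight XY2 eqn_leq gp // andbT.
have XI : #|X :&: Y| <= 2 * m.
  by apply: leq_trans XY2; rewrite subset_leq_card // subIset // subsetUl.
move: tX tY (gp _ XI) => /andP[_ /eqP tX] /andP[_ /eqP tY].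
have := subset_leq_card (reachI p X Y).
have := cardsUI (reach p X) (reach p Y); have := cardsUI X Y.
by rewrite reachU tX tY; nia.
Qed.

(* Tight sets avoiding v are closed under union. If each free neighbour r of v were reached by a
   tight set avoiding v, then the union of these sets together with v would reach too little. *)
Lemma attach_extendable p v : extendable p -> #|dom p| <= W -> #|children p v| < D ->
  exists r, [/\ r \in R, p r = None, e v r & extendable (attach p r v)].
Proof.
move=> gp domW chv; have [vp hp] := gp.
pose bad := \bigcup_(X in [set X | tight p X && (v \notin X)]) X.
have /andP[tb vb] : tight p bad && (v \notin bad).
  rewrite /bad; elim/big_ind: _ => [|X Y /andP[tX vX] /andP[tY vY]|X]; last by rewrite inE.
    rewrite /tight cards0 !inE andbT muln0 cards_eq0 /=; apply/eqP/setP => r.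
    rewrite !inE; case: (p r) => [x|]; rewrite ?inE ?andbF //.
    by apply/andP => -[_ /exists_inP[x]]; rewrite inE.
  by rewrite tightU //= inE negb_or vX.
have bm := tight_small domW tb.
suff /exists_inP[r] : [exists r in nbrs_in [set v], (p r == None) && (r \notin reach p bad)].
  rewrite inE => /andP[rR /exists_inP[v' /set1P-> vr]] /andP[/eqP pr rbad].
  exists r; split=> //; split.
    by move=> r' x; rewrite ffunE; case: eqVneq => [-> [<-]|_ /vp].
  move=> X X2; rewrite leqNgt; apply/negP => ltX.
  have sub1 : reach p X :\ r \subset reach (attach p r v) X.
    apply/subsetP => r'; rewrite !inE ffunE => /and3P[r'r -> hr'] /=.
    by rewrite (negbTE r'r).
  have := subset_leq_card sub1; move=> le1.
  have := hp _ X2; rewrite (cardsD1 r (reach p X)) => le2.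
  (* The new child [r] is the only vertex that [X] can lose. A failing [X] thus reaches [r], is
     tight and avoids [v], which puts [r] into [reach p bad]. *)
  have rX : r \in reach p X by case: (r \in _) le2 => //; lia.
  have tX : tight p X.
    rewrite /tight X2 eqn_leq hp // andbT (cardsD1 r (reach p X)) rX; lia.
  have vX : v \notin X.
    apply/negP => vX; have rX' : r \in reach (attach p r v) X.
      by rewrite !inE ffunE eqxx rR.
    have : reach p X \subset reach (attach p r v) X.
      apply/subsetP => r' r'X; case: (eqVneq r' r) => [-> //|r'r].
      by apply: (subsetP sub1); rewrite in_setD1 r'r.
    move/subset_leq_card; have := hp _ X2; lia.
  case/negP: rbad; move: rX; rewrite !inE rR pr /= => /exists_inP[x xX xr].
  apply/exists_inP; exists x => //; apply/bigcupP; exists X => //.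
  by rewrite inE tX.
apply: contraLR chv => /exists_inPn none.
rewrite -leqNgt.
have bv2 : #|bad :|: [set v]| <= 2 * m.
  by apply: leq_trans (leq_card_setU _ _) _; rewrite cards1; lia.
have sub : reach p (bad :|: [set v]) \subset reach p bad :|: children p v.
  rewrite reachU subUset subsetUl /=; apply/subsetP => r rv; rewrite in_setU.
  case: (boolP (r \in reach p bad)) => //= rb; rewrite inE.
  move: (rv); rewrite inE => /andP[rR]; case pr: (p r) => [x|].
    by rewrite inE => /eqP->.
  move=> h; have := none r; rewrite inE rR h pr rb => /(_ isT) //.
have := hp _ bv2; have := leq_trans (subset_leq_card sub) (leq_card_setU _ _).
move: tb => /andP[_ /eqP->]; rewrite setUC cardsU1 vb; lia.
Qed.

(** In other words a free vertex of [R] has no children, so that a newly attached vertex is a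
    leaf. *)
Definition rooted p := forall r x, p r = Some x -> (x \notin R) || (p x != None).

Lemma dom_sub p q : subforest p q -> dom p \subset dom q.
Proof. by move=> pq; apply/subsetP => r; rewrite !inE => pr; rewrite pq. Qed.

(** Vertices are attached singly. While fewer than [D * #|L|] have been attached, some member of [L]
    has fewer than [D] children by pigeonhole, and [attach_extendable] gives it another one. *)
Lemma grow_level p L : extendable p -> rooted p ->
  (forall v, v \in L -> children p v = set0) ->
  (forall v, v \in L -> (v \notin R) || (p v != None)) ->
  #|dom p| + D * #|L| <= W ->
  exists q, [/\ extendable q, rooted q, subforest p q,
    #|dom q :\: dom p| = D * #|L| &
    forall r, r \in dom q :\: dom p -> exists2 v, v \in L & q r = Some v].
Proof.
move=> gp rp chL LR budget.
suff main s : s <= D * #|L| -> exists q, [/\ extendable q, rooted q,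
    subforest p q, #|dom q :\: dom p| = s &
    forall r, r \in dom q :\: dom p -> exists2 v, v \in L & q r = Some v].
  exact: main (leqnn _).
elim: s => [|s IHs] sL.
  by exists p; split=> //; rewrite ?setDv ?cards0 // => r; rewrite inE.
have [q [gq rq pq cq hq]] := IHs (ltnW sL).
have sdq : dom q = dom p :|: (dom q :\: dom p).
  by apply/setP => r; have := subsetP (dom_sub pq) r; rewrite !inE; case: (p r) => [x ->|_].
have cdq : #|dom q| = #|dom p| + s.
  rewrite sdq cardsU cq [X in _ - X](_ : _ = 0) ?subn0 //.
  by apply/eqP; rewrite cards_eq0; apply/eqP/setP => r; rewrite !inE andbA andbN.
have [v vL chv] : exists2 v, v \in L & #|children q v| < D.
  apply/exists_inP; apply: contraLR sL => /exists_inPn h; rewrite -leqNgt -cq.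
  apply: leq_trans (_ : \sum_(v in L) #|children q v| <= _).
    rewrite mulnC -sum_nat_const; apply: leq_sum => v /h; by rewrite -leqNgt.
  rewrite (eq_bigr (fun v => \sum_r (q r == Some v))); last first.
    by move=> v _; rewrite -sum1dep_card big_mkcond; apply: eq_bigr => r _; case: ifP.
  rewrite exchange_big /= -sum1_card [X in _ <= X]big_mkcond /=.
  apply: leq_sum => r _; case qr: (q r) => [x|]; last by rewrite big1.
  have [xL|xL] := boolP (x \in L); last first.
    rewrite big1 // => v vL; case: eqP => // -[vx].
    by rewrite vx vL in xL.
  rewrite (bigD1 x) //= eqxx big1 ?addn0 => [|v /andP[_ vx]]; last first.
    by case: eqP => // -[xv]; rewrite xv eqxx in vx.
  rewrite !inE qr andbT negbK; case: eqP => // /eqP pr.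
  have : r \in children p x by rewrite inE -qr pq.
  by rewrite chL // inE.
have [|r [rR qr vr gr]] := attach_extendable gq _ chv.
  by rewrite cdq; lia.
have qa : subforest q (attach q r v).
  by move=> r'; rewrite ffunE; case: (eqVneq r' r) => [->|//]; rewrite qr.
have pr : p r = None.
  by case pr: (p r) => [x|] //; move: qr; rewrite pq ?pr.
exists (attach q r v); split=> //.
- move=> r' x; rewrite !ffunE; case: (eqVneq r' r) => [_ [<-]|_ /rq].
    case: (eqVneq v r) => [|_]; first by rewrite orbT.
    by move: (LR v vL); case: (boolP (v \notin R)) => //= _ pv; rewrite pq.
  by case: (eqVneq x r) => [|_] //; rewrite orbT.
- exact: subforest_trans qa.
- have -> : dom (attach q r v) :\: dom p = r |: (dom q :\: dom p).
    by apply/setP => r'; rewrite !inE ffunE; case: (eqVneq r' r) => [->|//]; rewrite pr.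
  by rewrite cardsU1 !inE qr pr /= cq.
- move=> r'; rewrite !inE ffunE; case: (eqVneq r' r) => [_ _|_ h]; first by exists v.
  by apply: hq; rewrite !inE.
Qed.
End Forests.

(** * Connecting the components of a class *)

Section Merging.
Variables (V : finType) (e : rel V) (R : {set V}) (D m W : nat).
Implicit Types (p q : {ffun V -> option V}) (X Y L F Z : {set V}) (c : seq V).
Hypothesis m_gt0 : 0 < m.
Hypothesis D_gt1 : 1 < D.
Hypothesis expand : forall X, m < #|X| <= 2 * m -> W + D * #|X| < #|nbrs_in e R X|.
Local Notation extendable := (extendable e R D m).
Local Notation rooted := (rooted R).

Definition chain p q v c :=
  path (fun x y => q y == Some x) v c && all (fun y => p y == None) c.

Lemma chain_sub p q q' v c : subforest p q -> subforest q q' ->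
  chain p q v c -> chain p q' v c.
Proof.
move=> pq qq' /andP[pc ac]; rewrite /chain ac andbT.
elim: c v pc ac => //= y c IHc v /andP[/eqP qy pc] /andP[_ ac].
by rewrite qq' ?qy // eqxx IHc.
Qed.

(** Each level is grown from the leaves of the previous one, and the level sizes form a geometric
    sum with ratio [D >= 2]. The clause on parents shows that the other roots receive no
    children. *)
Lemma grow_tree p v l : extendable p -> rooted p -> children p v = set0 ->
  (v \notin R) || (p v != None) -> #|dom p| + 2 * D ^ l <= W ->
  exists q L, [/\ extendable q, rooted q, subforest p q &
    [/\ #|dom q| <= #|dom p| + 2 * D ^ l, #|L| = D ^ l,
     forall r x, q r = Some x -> [\/ p r = Some x, x = v | x \in R /\ p x = None] &
     forall s, s \in L -> children q s = set0 /\
       exists c, [/\ size c = l, chain p q v c & last v c = s]]].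
Proof.
move=> gp rp chv vR budget.
(* The induction needs the sharper bound [D + ... + D ^ l <= 2 * D ^ l - 2]. *)
suff [q [L [gq rq pq [cq cL qE [hL chL _]]]]] :
  exists q L, [/\ extendable q, rooted q, subforest p q &
    [/\ #|dom q| + 2 <= #|dom p| + 2 * D ^ l, #|L| = D ^ l,
     forall r x, q r = Some x -> [\/ p r = Some x, x = v | x \in R /\ p x = None] &
     [/\ forall s, s \in L -> exists c, [/\ size c = l, chain p q v c & last v c = s],
         forall s, s \in L -> children q s = set0 &
         forall s, s \in L -> (s \notin R) || (q s != None)]]].
  exists q, L; split=> //; split=> //; first by move: cq; lia.
  by move=> s sL; split; [exact: chL | exact: hL].
elim: l budget => [|l IHl] budget.
  exists p, [set v]; split=> //; split; rewrite ?cards1 ?expn0 ?muln1 //.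
  - by move=> r x; constructor 1.
  - by split=> s /set1P-> //; exists [::]; split.
have Dl : 2 * D ^ l + D * D ^ l <= 2 * D ^ l.+1.
  by rewrite expnS; move: (D ^ l) => a; nia.
have [|q [L [gq rq pq [cq cL qE [hL chL LR]]]]] := IHl.
  by apply: leq_trans budget; rewrite leq_add2l; move: Dl; lia.
have [|q' [gq' rq' qq' cq' newE]] := grow_level m_gt0 expand gq rq chL LR.
  by rewrite cL; move: budget Dl cq; lia.
have pq' := subforest_trans pq qq'.
have newP r x : q' r = Some x -> q r = Some x \/ (r \in dom q' :\: dom q /\ x \in L).
  move=> q'r; case: (boolP (r \in dom q)) => rq0.
    by left; rewrite -q'r qq' //; rewrite inE in rq0.
  right; have rn : r \in dom q' :\: dom q by rewrite in_setD rq0 inE q'r.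
  by split=> //; have [w wL] := newE _ rn; rewrite q'r => -[->].
have LE s : s \in L -> s = v \/ s \in R /\ p s = None.
  move=> /hL[c [_ /andP[pc ac]]]; case/lastP: c pc ac => [_ _ <-|c w]; first by left.
  rewrite last_rcons rcons_path all_rcons => /andP[_ /eqP qw] /andP[/eqP pw _] <-; right.
  by split=> //; have [/(_ _ _ qw)[]] := gq.
exists q', (dom q' :\: dom q); split=> //; split.
- rewrite -(cardsID (dom q) (dom q')) (setIidPr (dom_sub qq')) cq' cL; lia.
- by rewrite cq' cL expnS.
- move=> r x /newP[/qE //|[_ /LE[->|xR]]]; [by constructor 2 | by constructor 3].
split=> s sn.
- have [w wL q's] := newE _ sn; have [c [sc hc lc]] := hL _ wL.
  exists (rcons c s); rewrite size_rcons sc last_rcons; split=> //.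
  have /andP[pc ac] := chain_sub pq qq' hc.
  rewrite /chain rcons_path all_rcons pc ac lc q's eqxx andbT /=.
  case ps : (p s) => [x|] //; move: sn; rewrite !inE.
  by rewrite pq ?ps.
(* The leaf [s] was a free vertex of [R] before this level, so [q] gave it no child. It is not in
   [L] either, whose members are outside [R] or already attached. *)
- apply/setP => r; rewrite !inE; apply/eqP => /newP[qr|[_ sL]].
    have /orP[sR|qs] := rq _ _ qr.
      have [w _ q's] := newE _ sn; have [/(_ _ _ q's)[]] := gq'.
      by rewrite (negbTE sR).
    by move: sn; rewrite !inE qs.
  have := LR _ sL; move: sn; rewrite !inE => /andP[/negbTE-> q's]; rewrite orbF.
  case q's' : (q' s) q's => [x|] // _; have [/(_ _ _ q's')[->]] := gq'.
  by [].
- by move: sn; rewrite !inE => /andP[_ ->]; rewrite orbT.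
Qed.

Lemma chain_mem p q v c y : chain p q v c -> y \in c ->
  p y = None /\ exists2 x, x \in v :: c & q y = Some x.
Proof.
move=> /andP[pc ac] yc; split; first by apply/eqP/(allP ac).
elim: c v pc yc {ac} => //= a c IHc v /andP[/eqP qa pc].
rewrite inE => /orP[/eqP->|yc]; first by exists v; rewrite // mem_head.
by have [x xc qy] := IHc _ pc yc; exists x; rewrite // in_cons xc orbT.
Qed.

Local Notation within F := [rel u v in F | e u v].

Lemma chain_connect p q v c F y : extendable q -> chain p q v c ->
  v \in F -> {subset c <= F} -> y \in v :: c -> connect (within F) v y.
Proof.
move=> [vq _] /andP[pc _] vF cF; apply: path_connect => //.
elim: c v pc vF cF => //= a c IHc v /andP[/eqP qa pc] vF cF.
have aF : a \in F by rewrite cF // mem_head.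
have [_ va] := vq _ _ qa.
by rewrite vF aF va /=; apply: IHc => // x xc; rewrite cF // in_cons xc orbT.
Qed.

Lemma connect_within F F' x y : F \subset F' ->
  connect (within F) x y -> connect (within F') x y.
Proof.
move=> FF'; apply: connect_sub => a b /= /andP[/andP[aF bF] ab].
by apply: connect1; rewrite /= !(subsetP FF') // ab.
Qed.

Definition prune p q X := [ffun y => if y \in X then q y else p y].

(** Of the new branches only [X] is kept, a set closed under passing to parents until the old forest
    or a root is met. Extendability needs no counting, because the result is a subforest of [q]. *)
Lemma prune_spec p q X : subforest p q -> extendable q -> rooted p ->
  (forall y, y \in X -> p y = None /\ exists2 x, q y = Some x &
    (x \in X) || (x \notin R) || (p x != None)) ->
  [/\ extendable (prune p q X), rooted (prune p q X), subforest p (prune p q X),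
      dom (prune p q X) = dom p :|: X &
      forall r x, prune p q X r = Some x -> p r = Some x \/ q r = Some x].
Proof.
move=> pq gq rp hX.
have sub : subforest (prune p q X) q.
  by move=> r; rewrite ffunE; case: ifP => // _ /pq.
have domE : dom (prune p q X) = dom p :|: X.
  apply/setP => r; rewrite !inE ffunE orbC; case: ifP => //= /hX[_ [x ->]] //.
split=> //.
- exact: extendable_sub gq.
- move=> r x; rewrite !ffunE; case: ifP => [/hX[_ [w ->]]|_ /rp].
    move=> + [<-]; case: (boolP (w \in X)) => [/hX[_ [a ->]]|_]; first by rewrite orbT.
    by [].
  case/orP => [->//|px]; case: ifP => [/hX[pN]|_]; last by rewrite px orbT.
  by rewrite pN in px.
- move=> r pr; rewrite ffunE; case: ifP => // /hX[pN].
  by rewrite pN in pr.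
- by move=> r x; rewrite ffunE; case: ifP; [right | left].
Qed.

Definition joined N := forall X Y, N <= #|X| -> N <= #|Y| ->
  exists x y, [/\ x \in X, y \in Y & e x y].

(* The representatives Z of the components of F still have no child, so that the next connecting
   path can start at any of them. *)
Definition state p F Z :=
  [/\ extendable p, rooted p,
      forall z, z \in Z -> [/\ z \in F, children p z = set0 & (z \notin R) || (p z != None)] &
      forall x, x \in F -> exists2 z, z \in Z & connect (within F) z x].

Hypothesis symE : symmetric e.

Lemma within_sym F : connect_sym (within F).
Proof.
by apply: sym_connect_sym => x y /=; rewrite symE [(x \in F) && _]andbC.
Qed.

(* If |V| < D^l |Z| then for some z in Z fewer than D^l free vertices see no component but that of
   z, and a tree of depth l grown from z has a leaf that sees another one. Otherwise two such trees
   are joined by an edge between their leaves. All of the trees but the connecting path is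
   discarded. *)
Lemma merge_step p F Z l : state p F Z ->
  (forall r, r \in R -> exists2 y, y \in F & e r y) ->
  1 < #|Z| -> 0 < l -> #|dom p| + 4 * D ^ l <= W ->
  #|V| < D ^ l * #|Z| \/ joined (D ^ l) ->
  exists q F' Z', [/\ state q F' Z', subforest p q, (#|Z'|).+1 = #|Z| &
    [/\ F \subset F', F' \subset F :|: (dom q :\: dom p), #|dom q| <= #|dom p| + 2 * l &
      forall x, x \notin Z -> (x \notin R) || (p x != None) -> children q x = children p x]].
Proof.
move=> [gp rp hZ covF] domF Z1 l0 budget big.
have csym := within_sym.
(* Of two representatives of the same component one is dropped at no cost. *)
have [/exists_inP[z zZ /exists_inP[z' z'Z /andP[zz' czz']]]|] :=
    boolP [exists z in Z, [exists z' in Z, (z != z') && connect (within F) z z']].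
  exists p, F, (Z :\ z); split=> //; first split=> //.
  - by move=> w /setD1P[_ /hZ].
  - move=> x /covF[w wZ cwx]; case: (eqVneq w z) => [wz|wz]; last first.
      by exists w; rewrite // !inE wz.
    exists z'; first by rewrite !inE eq_sym zz'.
    by apply: connect_trans cwx; rewrite wz csym.
  - by rewrite (cardsD1 z Z) zZ.
  - by rewrite subsetUl leq_addr.
move=> /exists_inPn sep.
have {}sep z z' : z \in Z -> z' \in Z -> connect (within F) z z' -> z = z'.
  move=> zZ z'Z c; apply/eqP; apply: contraTT c => zz'.
  by have /exists_inPn/(_ _ z'Z) := sep z zZ; rewrite zz'.
have RZ x z : x \in R -> p x = None -> z \in Z -> x != z.
  move=> xR px /hZ[_ _]; apply: contraTneq => <-.
  by rewrite xR px.
have l_none q z c : 0 < size c -> chain p q z c -> p (last z c) = None.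
  case/lastP: c => // c y _ h; rewrite last_rcons.
  by have [] := chain_mem h (y := y); rewrite // mem_rcons mem_head.
have noch w r : w \in Z -> p r = Some w -> False.
  move=> wZ pr; have [_ chw _] := hZ _ wZ.
  have : r \in children p w by rewrite inE pr.
  by rewrite chw inE.
case: big => [bigZ|joinD].
  (* The sets [K z] are disjoint because every vertex of [R] sees [F]. Their sizes add up to at most
     [#|V|], so one of them is below [D ^ l]. *)
  pose K z := [set r in R | (p r == None) && [forall y in F, e r y ==> connect (within F) z y]].
  have [z zZ Kz] : exists2 z, z \in Z & #|K z| < D ^ l.
    apply/exists_inP; apply: contraLR bigZ => /exists_inPn h; rewrite -leqNgt mulnC.
    apply: leq_trans (_ : \sum_(z in Z) #|K z| <= _).
      by rewrite -sum_nat_const; apply: leq_sum => z /h; rewrite -leqNgt.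
    rewrite (eq_bigr (fun z => \sum_r (r \in K z))); last first.
      by move=> z _; rewrite -sum1_card big_mkcond; apply: eq_bigr => r _; case: ifP.
    rewrite exchange_big /= -sum1_card; apply: leq_sum => r _.
    have [/exists_inP[z zZ rz]|] := boolP [exists z in Z, r \in K z]; last first.
      by move=> /exists_inPn no; rewrite big1 // => z /no/negbTE->.
    rewrite (bigD1 z) //= big1 ?addn0 ?leq_b1 // => z' /andP[z'Z z'z].
    apply/eqP; rewrite eqb0; apply: contra z'z => rz'; apply/eqP.
    move: rz rz'; rewrite !inE => /and3P[rR _ /forall_inP h1] /and3P[_ _ /forall_inP h2].
    have [y yF ry] := domF _ rR.
    apply: sep => //; apply: connect_trans (implyP (h2 _ yF) ry) _.
    by rewrite csym; apply: (implyP (h1 _ yF) ry).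
  have [zF chz zR] := hZ _ zZ.
  have [|q [L [gq rq pq [cq cL qE hL]]]] := grow_tree gp rp chz zR (l := l).
    by apply: leq_trans budget; rewrite leq_add2l leq_mul.
  have /subsetPn[s sL sK] : ~~ (L \subset K z).
    by apply/negP => /subset_leq_card; rewrite cL leqNgt Kz.
  have [chs [c [sc hc lc]]] := hL _ sL.
  have c0 : 0 < size c by rewrite sc.
  have sc' : s \in c by rewrite -lc; case: (c) c0 => //= a c1 _; exact: mem_last.
  have [ps [w _ qs]] := chain_mem hc sc'.
  have [sR _] : s \in R /\ e w s by have [/(_ _ _ qs)] := gq.
  have [y yF [sy czy]] : exists2 y, y \in F & e s y /\ ~~ connect (within F) z y.
    move: sK; rewrite inE sR ps eqxx /= negb_forall_in => /exists_inP[y yF].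
    by rewrite negb_imply => /andP[]; exists y.
  have [z2 z2Z cz2y] := covF _ yF.
  have z2z : z2 != z by apply: contraNneq czy => <-.
  pose X := [set x in c].
  have [|gq' rq' pq' dq' qE'] := @prune_spec p q X pq gq rp.
    move=> x; rewrite inE => /(chain_mem hc)[-> [a ac qa]]; split=> //.
    exists a => //; move: ac; rewrite !inE => /orP[/eqP->|->] //.
    by rewrite -orbA zR orbT.
  set q' := prune p q X in gq' rq' pq' dq' qE'.
  have subF : F \subset F :|: X by rewrite subsetUl.
  have cF : {subset c <= F :|: X} by move=> x xc; rewrite !inE xc orbT.
  have conn x : x \in z :: c -> connect (within (F :|: X)) z x.
    by apply: (chain_connect gq hc); rewrite // inE zF.
  have czz2 : connect (within (F :|: X)) z2 z.
    apply: (connect_trans (connect_within subF cz2y)); rewrite csym.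
    apply: (connect_trans (conn s _)); first by rewrite in_cons sc' orbT.
    by apply: connect1; rewrite /= cF // inE yF.
  have disX x : x \in X -> x \notin dom p.
    by rewrite !inE => /(chain_mem hc)[->].
  (* [z] now has a child and is given up; [z2] represents the merged component. *)
  exists q', (F :|: X), (Z :\ z); split=> //; [split=> // | | split=> //].
  - move=> w0 /setD1P[w0z w0Z]; have [w0F chw w0R] := hZ _ w0Z.
    split; first by rewrite inE w0F.
      apply/setP => r; rewrite !inE; apply/eqP => /qE'[/noch-/(_ w0Z) //|qr].
      have [/noch-/(_ w0Z) //|w0z'|[w0R' pw0]] := qE _ _ qr.
      + by rewrite w0z' eqxx in w0z.
      + by rewrite w0R' pw0 in w0R.
    by case/orP: w0R => [->//|pw0]; rewrite pq' // pw0 orbT.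
  - move=> x; rewrite inE => /orP[/covF[w0 w0Z cw0]|].
      case: (eqVneq w0 z) => [w0z|w0z].
        exists z2; first by rewrite !inE z2z.
        by apply: connect_trans czz2 _; apply: connect_within subF _; rewrite -w0z.
      by exists w0; [rewrite !inE w0z | exact: connect_within cw0].
    rewrite inE => xc; exists z2; first by rewrite !inE z2z.
    by apply: connect_trans czz2 _; apply: conn; rewrite in_cons xc orbT.
  - by rewrite (cardsD1 z Z) zZ.
  - apply/setUS/subsetP => x xX; rewrite inE disX // dq' inE xX orbT //.
  - rewrite dq'; apply: leq_trans (leq_card_setU _ _) _; rewrite leq_add2l.
    apply: leq_trans (_ : size c <= _); last by rewrite sc leq_pmull.
    by rewrite cardsE card_size.
  - move=> x xZ xR; apply/setP => r; rewrite !inE; apply/eqP/eqP => [|pr]; last first.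
      by rewrite pq' ?pr.
    case/qE' => // qr; have [//|xz|[xR' px]] := qE _ _ qr; first by rewrite xz zZ in xZ.
    by rewrite xR' px in xR.
have /card_gt1P[z [z' [zZ z'Z zz']]] := Z1.
have [zF chz zR] := hZ _ zZ; have [z'F chz' z'R] := hZ _ z'Z.
have [|q1 [L1 [gq1 rq1 pq1 [cq1 cL1 qE1 hL1]]]] := grow_tree gp rp chz zR (l := l).
  by apply: leq_trans budget; rewrite leq_add2l leq_mul.
have chz1 : children q1 z' = set0.
  apply/setP => r; rewrite !inE; apply/eqP => /qE1[/noch-/(_ z'Z) //|z'z|[z'R' pz']].
    by rewrite z'z eqxx in zz'.
  by rewrite z'R' pz' in z'R.
have z'R1 : (z' \notin R) || (q1 z' != None).
  by case/orP: z'R => [->//|pz']; rewrite pq1 // pz' orbT.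
have [|q [L2 [gq rq q1q [cq cL2 qE2 hL2]]]] := grow_tree gq1 rq1 chz1 z'R1 (l := l).
  by move: budget cq1; lia.
have pq := subforest_trans pq1 q1q.
have [s1 [s2 [s1L s2L s12]]] : exists s1 s2, [/\ s1 \in L1, s2 \in L2 & e s1 s2].
  by apply: joinD; rewrite ?cL1 ?cL2.
have [_ [c1 [sc1 hc1 lc1]]] := hL1 _ s1L.
have [chs2 [c2 [sc2 hc2 lc2]]] := hL2 _ s2L.
have {}hc1 : chain p q z c1 := chain_sub pq1 q1q hc1.
have {}hc2 : chain p q z' c2.
  case/andP: hc2 => pc2 ac2; rewrite /chain pc2; apply: sub_all ac2 => x /eqP q1x.
  by apply/eqP; case px: (p x) => [w|] //; move: q1x; rewrite pq1 px.
have s2c : s2 \in c2.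
  rewrite -lc2; case: (c2) sc2 => [l00|a c _] /=; last exact: mem_last.
  by rewrite -l00 in l0.
have s1c : s1 \in c1.
  rewrite -lc1; case: (c1) sc1 => [l00|a c _] /=; last exact: mem_last.
  by rewrite -l00 in l0.
have [ps2 [w _ qs2]] := chain_mem hc2 s2c.
have [s2R _] : s2 \in R /\ e w s2 by have [/(_ _ _ qs2)] := gq.
have s2Z : s2 \notin Z by apply/negP => /(RZ _ _ s2R ps2); rewrite eqxx.
pose X := [set x in c1 ++ c2].
have XP x : x \in X -> p x = None /\ exists2 a, q x = Some a &
    [\/ a \in X, a = z | a = z'].
  rewrite inE mem_cat => /orP[/(chain_mem hc1)|/(chain_mem hc2)] [-> [a]];
    rewrite inE => /orP[/eqP->|ac] qx; split=> //.
  - by exists z => //; constructor 2.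
  - by exists a => //; constructor 1; rewrite inE mem_cat ac.
  - by exists z' => //; constructor 3.
  - by exists a => //; constructor 1; rewrite inE mem_cat ac orbT.
have [|gq' rq' pq' dq' qE'] := @prune_spec p q X pq gq rp.
  move=> x /XP[-> [a qa aX]]; split=> //; exists a => //.
  by case: aX => [->|->|->] //; rewrite -orbA ?zR ?z'R orbT.
set q' := prune p q X in gq' rq' pq' dq' qE'.
have qE r x : q r = Some x -> [\/ p r = Some x, x = z, x = z' | x \in R /\ p x = None].
  case/qE2 => [/qE1[h|h|h]|h|[xR q1x]].
  - by constructor 1.
  - by constructor 2.
  - by constructor 4.
  - by constructor 3.
  - constructor 4; split=> //; case px: (p x) => [a|] //.
    by move: q1x; rewrite pq1 px.
have subF : F \subset F :|: X by rewrite subsetUl.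
have c1F : {subset c1 <= F :|: X} by move=> x xc; rewrite !inE mem_cat xc orbT.
have c2F : {subset c2 <= F :|: X} by move=> x xc; rewrite !inE mem_cat xc !orbT.
have conn1 x : x \in z :: c1 -> connect (within (F :|: X)) z x.
  by apply: (chain_connect gq hc1); rewrite // inE zF.
have conn2 x : x \in z' :: c2 -> connect (within (F :|: X)) z' x.
  by apply: (chain_connect gq hc2); rewrite // inE z'F.
have cs2z' : connect (within (F :|: X)) s2 z'.
  by rewrite csym; apply: conn2; rewrite in_cons s2c orbT.
have cs2z : connect (within (F :|: X)) s2 z.
  rewrite csym; apply: connect_trans (conn1 s1 _) _; first by rewrite in_cons s1c orbT.
  by apply: connect1; rewrite /= c1F // c2F.
have disX x : x \in X -> x \notin dom p by move/XP => [px _]; rewrite inE px.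
(* Both [z] and [z'] now have children, so the leaf [s2] takes over as representative of the merged
   component. *)
exists q', (F :|: X), (s2 |: (Z :\ z :\ z')); split=> //; [split=> // | | split=> //].
- move=> w0; rewrite in_setU1 => /orP[/eqP->|/setD1P[w0z' /setD1P[w0z w0Z]]].
    have s2X : s2 \in X by rewrite inE mem_cat s2c orbT.
    split; first by rewrite inE s2X orbT.
      apply/setP => r; rewrite !inE; apply/eqP => /qE'[/rp|qr].
        by rewrite s2R ps2.
      by have /setP/(_ r) := chs2; rewrite !inE qr eqxx.
    by rewrite ffunE s2X qs2 orbT.
  have [w0F chw w0R] := hZ _ w0Z.
  split; first by rewrite inE w0F.
    apply/setP => r; rewrite !inE; apply/eqP => /qE'[/noch-/(_ w0Z) //|qr].
    have [/noch-/(_ w0Z) //|w0E|w0E|[w0R' pw0]] := qE _ _ qr.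
    + by rewrite w0E eqxx in w0z.
    + by rewrite w0E eqxx in w0z'.
    + by rewrite w0R' pw0 in w0R.
  by case/orP: w0R => [->//|pw0]; rewrite pq' // pw0 orbT.
- move=> x; rewrite inE => /orP[/covF[w0 w0Z cw0]|].
    case: (eqVneq w0 z) => [w0z|w0z].
      exists s2; first by rewrite setU11.
      by apply: connect_trans cs2z _; apply: connect_within subF _; rewrite -w0z.
    case: (eqVneq w0 z') => [w0z'|w0z'].
      exists s2; first by rewrite setU11.
      by apply: connect_trans cs2z' _; apply: connect_within subF _; rewrite -w0z'.
    exists w0; last exact: connect_within cw0.
    by rewrite !inE w0z w0z' w0Z orbT.
  rewrite inE mem_cat => /orP[] xc; exists s2; rewrite ?setU11 //.
    by apply: connect_trans cs2z _; apply: conn1; rewrite in_cons xc orbT.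
  by apply: connect_trans cs2z' _; apply: conn2; rewrite in_cons xc orbT.
- rewrite cardsU1 !inE (negbTE s2Z) !andbF /= (cardsD1 z Z) zZ.
  by rewrite (cardsD1 z' (Z :\ z)) !inE z'Z eq_sym zz'.
- apply/setUS/subsetP => x xX; rewrite inE disX // dq' inE xX orbT //.
- rewrite dq'; apply: leq_trans (leq_card_setU _ _) _; rewrite leq_add2l.
  apply: leq_trans (_ : size (c1 ++ c2) <= _); last by rewrite size_cat sc1 sc2 mul2n addnn.
  by rewrite cardsE card_size.
- move=> x xZ xR; apply/setP => r; rewrite !inE; apply/eqP/eqP => [|pr]; last first.
    by rewrite pq' ?pr.
  case/qE' => // qr; have [//|xz|xz|[xR' px]] := qE _ _ qr.
  - by rewrite xz zZ in xZ.
  - by rewrite xz z'Z in xZ.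
  - by rewrite xR' px in xR.
Qed.
End Merging.

(** * All components of all classes *)

Section Connecting.
Variables (V : finType) (e : rel V) (R : {set V}) (D m W : nat).
Implicit Types (p q : {ffun V -> option V}) (X Y L F Z : {set V}).
Hypothesis m_gt0 : 0 < m.
Hypothesis D_gt1 : 1 < D.
Hypothesis expand : forall X, m < #|X| <= 2 * m -> W + D * #|X| < #|nbrs_in e R X|.
Hypothesis symE : symmetric e.
Local Notation extendable := (extendable e R D m).
Local Notation rooted := (rooted R).
Local Notation within F := [rel u v in F | e u v].
Variables (U : nat) (depth : nat -> nat).
Hypothesis depth_ok : forall c, 1 < c ->
  [/\ 0 < depth c, U + 4 * D ^ depth c <= W &
      #|V| < D ^ depth c * c \/ joined e (D ^ depth c)].

(** Passing from [c] to [c - 1] components adds at most [2 * depth c] vertices to the forest. *)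
Definition cost n := \sum_(2 <= c < n.+1) 2 * depth c.

Lemma dom_extendable p : extendable p -> dom p \subset R.
Proof.
move=> [vp _]; apply/subsetP => r; rewrite inE; case pr: (p r) => [x|] // _.
by have [] := vp _ _ pr.
Qed.

(** Each use of [merge_step] leaves one representative fewer. The last clause keeps the vertices of
    the other classes childless, so that their representatives can later serve as roots. *)
Lemma merge_all p F Z : state e R D m p F Z ->
  (forall r, r \in R -> exists2 y, y \in F & e r y) ->
  #|dom p| + cost #|Z| <= U ->
  exists q F', [/\ extendable q, rooted q, subforest p q & 
    [/\ F \subset F' /\ F' \subset F :|: (dom q :\: dom p), #|dom q| <= #|dom p| + cost #|Z|,
      connected_set e F' &
      forall x, x \notin R -> x \notin F -> children q x = children p x]].
Proof.
have [n] := ubnP #|Z|; elim: n p F Z => // n IHn p F Z; rewrite ltnS => leZ sp domF budget.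
have [gp rp hZ covF] := sp.
have [Z1|Z1] := leqP #|Z| 1.
  exists p, F; split=> //; split; rewrite ?subsetUl ?leq_addr //.
  move=> x y xF yF; have [z zZ czx] := covF _ xF; have [z' z'Z cz'y] := covF _ yF.
  have /card_le1_eqP zz := Z1.
  by apply: connect_trans cz'y; rewrite (zz z z' zZ z'Z) (within_sym symE).
have [l0 lW big] := depth_ok Z1.
have costS : cost #|Z| = cost #|Z|.-1 + 2 * depth #|Z|.
  by rewrite /cost; case: #|Z| Z1 => // c c1; rewrite big_nat_recr.
have [|q [F1 [Z' [sq pq cZ [FF1 F1F cq frame]]]]] :=
    merge_step m_gt0 D_gt1 expand symE sp domF Z1 l0 _ big.
  by apply: leq_trans lW; rewrite leq_add2r; move: budget; lia.
have cZ' : #|Z'| = #|Z|.-1 by rewrite -cZ.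
have [gq rq _ _] := sq.
have domF1 r : r \in R -> exists2 y, y \in F1 & e r y.
  by move=> rR; have [y yF ry] := domF _ rR; exists y; rewrite // (subsetP FF1).
have ltZ' : #|Z'| < n by rewrite cZ'; move: Z1 leZ; lia.
have [|q' [F2 [gq' rq' qq' [[F12 F2F] cq' conF frame']]]] := IHn q F1 Z' ltZ' sq domF1.
  by rewrite cZ'; move: budget cq; rewrite costS; lia.
exists q', F2; split=> //; first exact: subforest_trans pq qq'.
split=> //; first split; first exact: subset_trans F12.
- apply/subsetP => x /(subsetP F2F); rewrite inE => /orP[/(subsetP F1F)|].
      rewrite inE => /orP[xF|]; first by rewrite inE xF.
      by move=> /setDP[xq xp]; rewrite !in_setU in_setD xp (subsetP (dom_sub qq')) ?orbT.
    move=> /setDP[xq xp]; rewrite !in_setU in_setD xq andbT.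
    by rewrite (contra _ xp) ?orbT //; apply/subsetP/dom_sub.
- by move: cq' cq; rewrite cZ' costS; lia.
- move=> x xR xF; rewrite frame' //; last first.
    apply: contra xF => /(subsetP F1F); rewrite inE => /orP[//|/setDP[xq _]].
    by rewrite (subsetP (dom_extendable gq)) // in xR.
  by rewrite frame ?xR //; apply: contra xF; case/hZ.
Qed.

Theorem connect_all (k : nat) (Dm Zm : nat -> {set V}) :
  extendable [ffun=> None] ->
  (forall i, i < k -> [disjoint Dm i & R]) ->
  (forall i j, i < k -> j < k -> i != j -> [disjoint Dm i & Dm j]) ->
  (forall i r, i < k -> r \in R -> exists2 y, y \in Dm i & e r y) ->
  (forall i, i < k -> Zm i \subset Dm i) ->
  (forall i x, i < k -> x \in Dm i ->
    exists2 z, z \in Zm i & connect (within (Dm i)) z x) ->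
  \sum_(i < k) cost #|Zm i| <= U ->
  exists F : nat -> {set V},
   [/\ forall i, i < k -> Dm i \subset F i,
       forall i, i < k -> connected_set e (F i) &
       forall i j, i < k -> j < k -> i != j -> [disjoint F i & F j]].
Proof.
move=> g0 disR disD domD subZ covZ budget.
suff main j : j <= k -> exists p (F : nat -> {set V}), [/\ extendable p, rooted p,
    #|dom p| <= \sum_(i < j) cost #|Zm i| &
   [/\ forall i, i < j -> Dm i \subset F i /\ F i \subset Dm i :|: dom p,
       forall i, i < j -> connected_set e (F i),
       forall i i', i < j -> i' < j -> i != i' -> [disjoint F i & F i'] &
       forall i x, j <= i < k -> x \in Dm i -> children p x = set0]].
  have [p [F [_ _ _ [h1 h2 h3 _]]]] := main k (leqnn _).
  by exists F; split=> // i ik; have [] := h1 i ik.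
elim: j => [_|j IHj jk].
  exists [ffun=> None], (fun=> set0); split=> //.
  - by move=> r x; rewrite ffunE.
  - rewrite big_ord0 leqn0 cards_eq0; apply/eqP/setP => r.
    by rewrite !inE ffunE.
  - by split=> // i x _ _; apply/setP => r; rewrite !inE ffunE.
have [p [F [gp rp cp [h1 h2 h3 h4]]]] := IHj (ltnW jk).
have disRD i x : i < k -> x \in Dm i -> x \notin R.
  by move=> ik xD; rewrite (disjointFr (disR i ik)).
have sp : state e R D m p (Dm j) (Zm j).
  split=> // [z zZ|x]; last exact: covZ.
  have zD := subsetP (subZ _ jk) _ zZ.
  by split=> //; [apply: h4 zD; rewrite leqnn | rewrite (disRD j)].
have sumS : \sum_(i < j.+1) cost #|Zm i| <= U.
  apply: leq_trans budget; rewrite -!(big_mkord xpredT (fun i => cost #|Zm i|)).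
  by rewrite [X in _ <= X](big_cat_nat _ (n := j.+1)) //= leq_addr.
rewrite big_ord_recr /= in sumS.
have [||q [F' [gq rq pq [[DF FD] cq conF frame]]]] := merge_all sp.
- by move=> r; apply: domD.
- by apply: leq_trans sumS; rewrite leq_add2r.
have dpq := dom_sub pq.
have disF i : i < j -> [disjoint F i & F'].
  move=> ij; have ik : i < k := ltn_trans ij jk.
  rewrite -setI_eq0; apply/eqP/setP => x; rewrite !inE; apply/andP => -[xF xF'].
  have [_ /subsetP/(_ _ xF)] := h1 i ij; have := subsetP FD _ xF'.
  rewrite !in_setU in_setD => /orP[xDj|/andP[xp xq]] /orP[xDi|xp'].
  - have := disD i j ik jk; rewrite neq_ltn ij => /(_ isT) dis.
    by rewrite (disjointFr dis xDi) in xDj.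
  - by have := disRD j x jk xDj; rewrite (subsetP (dom_extendable gp)).
  - by have := disRD i x ik xDi; rewrite (subsetP (dom_extendable gq)).
  - by rewrite xp' in xp.
exists q, (fun i => if i == j then F' else F i); split=> //.
  by rewrite big_ord_recr /=; apply: leq_trans cq _; rewrite leq_add2r.
split.
- move=> i; rewrite ltnS leq_eqVlt; case: eqP => [->|_ /= ij].
    by split=> //; apply: subset_trans FD _; rewrite setUS // subsetDl.
  have [hi1 hi2] := h1 i ij; split=> //; apply: subset_trans hi2 _.
  exact: setUS.
- by move=> i; rewrite ltnS leq_eqVlt; case: eqP => [_ _|_ /= ij] //; exact: h2.
- move=> i i'; rewrite !ltnS (leq_eqVlt i) (leq_eqVlt i').
  case: (eqVneq i j) => [->|_]; case: (eqVneq i' j) => [->|_] //=; rewrite ?eqxx //.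
  + by move=> _ i'j _; rewrite disjoint_sym disF.
  + by move=> ij _ _; rewrite disF.
  + exact: h3.
- move=> i x /andP[ji ik] xD; rewrite frame; last 2 first.
  + exact: disRD xD.
  + have := disD i j ik jk; rewrite neq_ltn ji orbT => /(_ isT) dis.
    by rewrite (disjointFr dis xD).
  by apply: (h4 i x _ xD); rewrite ik andbT ltnW.
Qed.
End Connecting.

Import Order.TTheory GRing.Theory Num.Theory.
Local Open Scope ring_scope.

(** * Colour classes with large degrees *)

Section Moments.
Variables (R : realType) (V A : finType).
Hypothesis A_gt0 : (0 < #|A|)%N.
Local Notation N := (#|A|%:R : R).

Definition hits (H : V -> A -> bool) (f : {ffun V -> A}) : nat :=
  #|[set w | H w (f w)]|.

(** The mean of [hits H] over uniformly random functions is [weight H / #|A|]. *)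
Definition weight (H : V -> A -> bool) : nat := \sum_w #|[set a | H w a]|.

(** The values of a random function are independent, so the sum factors over [w], and each factor is
    bounded by [1 + x <= expR x]. *)
Lemma hits_moment (H : V -> A -> bool) (q : R) : 0 <= q <= 1 ->
  \sum_(f : {ffun V -> A}) q ^+ hits H f
  <= N ^+ #|V| * expR (- ((1 - q) * (weight H)%:R / N)).
Proof.
move=> /andP[q0 q1]; have N0 : 0 < N by rewrite ltr0n.
have -> : \sum_(f : {ffun V -> A}) q ^+ hits H f
    = \prod_w \sum_a (if H w a then q else 1).
  rewrite bigA_distr_bigA; apply: eq_bigr => f _.
  rewrite /hits -prodr_const big_mkcond /=; apply: eq_bigr => w _.
  by rewrite inE.
have -> : N ^+ #|V| * expR (- ((1 - q) * (weight H)%:R / N))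
    = \prod_w (N * expR (- ((1 - q) * #|[set a | H w a]|%:R / N))).
  rewrite big_split /= prodr_const -expR_sum; congr (_ * expR _).
  by rewrite sumrN -mulr_suml -mulr_sumr /weight natr_sum.
apply: ler_prod => w _; rewrite sumr_ge0 /= => [|a _]; last by case: ifP.
have -> : \sum_a (if H w a then q else 1) = N * (1 - (1 - q) * #|[set a | H w a]|%:R / N).
  rewrite mulrBr mulr1 mulrCA divff ?gt_eqF // mulr1.
  rewrite -sumr_const -[X in _ - _ * X]sumr_const mulr_sumr [X in _ - X]big_mkcond /= -sumrB.
  apply: eq_bigr => a _; rewrite inE; case: (H w a); rewrite ?subr0 //.
  by rewrite mulr1 opprB addrC subrK.
by rewrite ler_pM2l //; apply: le_trans (expR_ge1Dx _).
Qed.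

(** Markov's inequality for [q ^+ hits H f], which is at least [q ^+ y] on the event. *)
Lemma hits_tail (H : V -> A -> bool) (q : R) (y : nat) : 0 < q <= 1 ->
  #|[set f | (hits H f <= y)%N]|%:R * q ^+ y
  <= N ^+ #|V| * expR (- ((1 - q) * (weight H)%:R / N)).
Proof.
move=> /andP[q0 q1]; apply: le_trans (hits_moment H _); last by rewrite ltW.
rewrite mulr_natl -sumr_const big_mkcond /=; apply: ler_sum => f _.
rewrite inE; case: ifP => [fy|_]; last by rewrite exprn_ge0 // ltW.
by rewrite ler_wiXn2l // ltW.
Qed.
End Moments.

Definition colour_deg (V A : finType) (e : rel V) (f : {ffun V -> A}) (v : V) (c : A) : nat :=
  #|[set w | e v w && (f w == c)]|.

Definition missing (V A : finType) (e : rel V) (K : {set A}) (y : nat)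
    (f : {ffun V -> A}) (u : V) : {set A} :=
  [set c in K | [exists v, e u v && (colour_deg e f v c <= y)%N]].

(* 2^|missing| is the product over c in K of 1 + [c is missing], and c is missing only if
   q^(colour_deg v c - y) >= 1 for some neighbour v of u. Expanding the product after this bound
   leaves one exponential moment for each choice of a neighbour, or of none, for each colour. *)
Lemma missing_moment (R : realType) (V A : finType) (e : rel V) (d y : nat)
    (K : {set A}) (q : R) (u : V) :
  (0 < #|A|)%N -> regular e d -> 0 < q <= 1 ->
  \sum_(f : {ffun V -> A}) 2 ^+ #|missing e K y f u|
  <= #|A|%:R ^+ #|V| *
     (1 + d%:R * (q ^- y * expR (- ((1 - q) * d%:R / #|A|%:R)))) ^+ #|K|.
Proof.
move=> A0 reg /andP[q0 q1]; set N : R := #|A|%:R.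
set t := q ^- y; set E := expR _.
have t0 : 0 < t by rewrite invr_gt0 exprn_gt0.
have E0 : 0 < E by exact: expR_gt0.
pose g (f : {ffun V -> A}) (c : A) (o : option V) : R :=
  if o is Some v then if (c \in K) && e u v then t * q ^+ colour_deg e f v c else 0
  else 1.
pose h (c : A) (o : option V) : R :=
  if o is Some v then if (c \in K) && e u v then t * E else 0 else 1.
have sumo (F : option V -> R) : \sum_o F o = F None + \sum_v F (Some v).
  rewrite (bigD1 None) //=; congr (_ + _).
  rewrite (reindex_omap Some id) /=; last by case.
  by apply: eq_bigl => v; rewrite eqxx.
have step1 f : 2 ^+ #|missing e K y f u| <= \prod_c \sum_o g f c o.
  rewrite -prodr_const big_mkcond /=; apply: ler_prod => c _.
  have g0 v : 0 <= g f c (Some v).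
    by rewrite /=; case: ifP => // _; rewrite mulr_ge0 ?exprn_ge0 // ltW.
  rewrite sumo; case: ifP => [|_]; last by rewrite ler01 lerDl sumr_ge0.
  rewrite inE => /andP[cK /existsP[v /andP[uv cy]]]; rewrite ler0n /=.
  rewrite -[2]/(1 + 1) lerD2l (bigD1 v) //= cK uv /=.
  rewrite -[leLHS]addr0 lerD ?sumr_ge0 //; last first.
    by move=> w _; case: ifP => // _; rewrite mulr_ge0 ?exprn_ge0 // ltW.
  by rewrite /t mulrC ler_pdivlMr ?exprn_gt0 // mul1r ler_wiXn2l // ltW.
apply: le_trans (_ : \sum_(f : {ffun V -> A}) \sum_(k : {ffun A -> option V}) \prod_c g f c (k c) <= _).
  by apply: ler_sum => f _; rewrite -bigA_distr_bigA; exact: step1.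
rewrite exchange_big /=.
have -> : (1 + d%:R * (t * E)) ^+ #|K| = \prod_c \sum_o h c o.
  rewrite -prodr_const big_mkcond /=; apply: eq_bigr => c _; rewrite sumo /=.
  case: ifP => cK /=; last by rewrite big1 ?addr0.
  congr (_ + _); rewrite -big_mkcond /= sumr_const mulr_natl; congr (_ *+ _).
  by rewrite -(reg u) cardsE.
rewrite bigA_distr_bigA mulr_sumr; apply: ler_sum => k _.
(* A choice with a colour outside [K] or a vertex not adjacent to [u] contributes zero to both
   sides. *)
have [/forallP ok|] := boolP [forall c, if k c is Some v then (c \in K) && e u v else true]; last first.
  rewrite negb_forall => /existsP[c]; case kc: (k c) => [v|] // bad.
  rewrite big1 => [|f _]; last by rewrite (bigD1 c) //= kc /= (negbTE bad) mul0r.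
  by rewrite (bigD1 c) //= kc /= (negbTE bad) mul0r mulr0.
(* For a fixed choice [k] the product over the colours is a single exponential moment: a hit is a
   vertex adjacent to the neighbour chosen for its own colour. Each of the [s] chosen neighbours
   adds [d] to the weight. *)
pose H w c := if k c is Some v then e v w else false.
pose s := #|[set c | k c != None]|.
have prodg f : \prod_c g f c (k c) = t ^+ s * q ^+ hits H f.
  have -> : hits H f = (\sum_c (if k c is Some v then colour_deg e f v c else 0))%N.
    rewrite /hits -sum1dep_card.
    rewrite (partition_big f xpredT) //=; apply: eq_bigr => c _.
    case kc: (k c) => [v|]; last first.
      by rewrite big_pred0 // => w; apply/negP => /andP[+ /eqP fw]; rewrite /H fw kc.
    rewrite sum1dep_card; apply: eq_card => w; rewrite !inE.
    by case: eqP => [fw|]; rewrite ?andbF // !andbT /H fw kc.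
  rewrite /s -[t ^+ _]prodr_const [X in X * _]big_mkcond /=.
  rewrite expr_sum -big_split /=.
  apply: eq_bigr => c _; rewrite inE; have := ok c.
  by case: (k c) => [v /= ->|_] /=; rewrite ?mulr1.
have prodh : \prod_c h c (k c) = t ^+ s * E ^+ s.
  rewrite -exprMn /s -[(t * E) ^+ _]prodr_const [RHS]big_mkcond /=.
  apply: eq_bigr => c _; rewrite inE; have := ok c.
  by case: (k c) => [v /= ->|_] /=.
rewrite prodh (eq_bigr _ (fun f _ => prodg f)) -mulr_sumr mulrCA ler_wpM2l ?exprn_ge0 ?(ltW t0) //.
apply: le_trans (hits_moment A0 H _) _; first by rewrite ltW.
rewrite ler_wpM2l ?exprn_ge0 // /E -expRM_natl.
have -> : weight H = (s * d)%N.
  rewrite /weight (eq_bigr (fun w => \sum_c (H w c : nat))%N); last first.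
    by move=> w _; rewrite -sum1dep_card big_mkcond; apply: eq_bigr => c _; case: ifP.
  rewrite exchange_big /= /s -sum_nat_const [RHS]big_mkcond /=.
  apply: eq_bigr => c _; rewrite inE /H; case: (k c) => [v|]; last by rewrite big1.
  rewrite -(reg v) -sum1dep_card [RHS]big_mkcond; apply: eq_bigr => w _.
  by case: ifP.
by rewrite natrM mulrN (mulrCA (1 - q)) -[_ * _ / _]mulrA.
Qed.

(** * The two random colourings *)

Section Colouring.
Variables (R : realType) (V : finType) (e : rel V) (d : nat).
Hypotheses (symE : symmetric e) (reg : regular e d) (d_gt0 : (0 < d)%N).

Definition class_deg (A : finType) (f : {ffun V -> A}) (v : V) (B : {set A}) : nat :=
  #|[set w | e v w && (f w \in B)]|.

Definition nbh (v : V) : {set V} := [set w | e v w].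
(** The first-phase event at [u] depends on the neighbours of [u] through the reserve degrees, and
    on their neighbours through the missing colours. *)
Definition nbh2 (u : V) : {set V} := nbh u :|: \bigcup_(v in nbh u) nbh v.

Lemma card_nbh_bigcup (X : {set V}) (F : V -> {set V}) (b : nat) :
  (forall v, #|F v| <= b)%N -> (#|\bigcup_(v in X) F v| <= #|X| * b)%N.
Proof.
move=> Fb; rewrite -sum_nat_const.
elim/big_ind2: _ => [|x1 x2 y1 y2 h1 h2|v _]; rewrite ?cards0 //.
by apply: leq_trans (leq_card_setU _ _) (leq_add h1 h2).
Qed.

Lemma card_nbh2 u : (#|nbh2 u| <= d + d * d)%N.
Proof.
apply: leq_trans (leq_card_setU _ _) _; rewrite {1}/nbh reg leq_add2l -{1}(reg u).
by apply: card_nbh_bigcup => v; rewrite reg.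
Qed.

Lemma nbh2_sym u w : (w \in nbh2 u) = (u \in nbh2 w).
Proof.
suff {u w} h u w : w \in nbh2 u -> u \in nbh2 w by apply/idP/idP; apply: h.
rewrite !inE symE => /orP[->//|/bigcupP[v]]; rewrite !inE => uv vw.
by apply/orP; right; apply/bigcupP; exists v; rewrite inE symE.
Qed.

Lemma sum_expr_card (A : finType) (a : nat) (F : {ffun V -> A} -> nat) (x : R) :
  1 <= x -> #|[set f | (a <= F f)%N]|%:R * x ^+ a <= \sum_f x ^+ F f.
Proof.
move=> x1; rewrite mulr_natl -sumr_const big_mkcond /=; apply: ler_sum => f _.
rewrite inE; case: ifP => [af|_]; first by rewrite ler_weXn2l.
by rewrite exprn_ge0 // (le_trans ler01).
Qed.

Lemma class_deg_tail (A : finType) (B : {set A}) (v : V) (r : nat) : (0 < #|A|)%N ->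
  #|[set f : {ffun V -> A} | (class_deg f v B <= r)%N]|%:R
  <= #|A|%:R ^+ #|V| * (2 ^+ r * expR (- (d%:R * #|B|%:R / (2 * #|A|%:R)))) :> R.
Proof.
move=> A0; pose H w c := e v w && (c \in B).
have q01 : 0 < (2^-1 : R) <= 1 by apply/andP; split; lra.
have := hits_tail A0 H r q01.
have -> : weight H = (d * #|B|)%N.
  rewrite -(reg v) -sum_nat_const [RHS]big_mkcond /weight.
  apply: eq_bigr => w _; rewrite inE /H; case: (e v w) => /=.
    by apply: eq_card => c; rewrite inE.
  by apply: eq_card0 => c; rewrite inE.
rewrite exprVn ler_pdivrMr ?exprn_gt0 ?ltr0n // => /le_trans; apply.
rewrite mulrAC -[leLHS]mulrA natrM invfM.
by have -> : (1 - 2^-1) * (d%:R * #|B|%:R) / #|A|%:R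
           = d%:R * #|B|%:R * (2^-1 / #|A|%:R) :> R by lra.
Qed.

(** The local lemma, with one event at each [u]: too few neighbours in one half of the reserve, or
    too long a list of missing colours. Each support has at most [d + d * d] vertices, and each
    vertex is in at most as many supports, hence the square. *)
Lemma phase_one (A : finType) (K KR KQ : {set A}) (a r l y : nat) (q : R) :
  (0 < #|A|)%N -> #|KR| = a -> #|KQ| = a -> 0 < q <= 1 ->
  (2 ^+ r * expR (- (d%:R * a%:R / (2 * #|A|%:R))) * 2
   + (1 + d%:R * (q ^- y * expR (- ((1 - q) * d%:R / #|A|%:R)))) ^+ #|K| / 2 ^+ l)
    * (4 * (d + d * d) ^ 2)%:R <= 1 ->
  exists f : {ffun V -> A}, forall u,
    [/\ (r < class_deg f u KR)%N, (r < class_deg f u KQ)%N & (#|missing e K y f u| < l)%N].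
Proof.
move=> A0 cR cQ q01 num.
pose B u := [set f : {ffun V -> A} | [|| class_deg f u KR <= r, class_deg f u KQ <= r |
  l <= #|missing e K y f u|]%N].
have dep u : depends_on (nbh2 u) (B u).
  move=> f g fg; have cd C : class_deg f u C = class_deg g u C.
    apply: eq_card => w; rewrite !inE; case uw: (e u w) => //=.
    by rewrite fg // !inE uw.
  rewrite !inE !cd; congr [|| _, _ | (_ <= #|pred_of_set _|)%N].
  apply/setP => c; rewrite !inE; congr (_ && _); apply: eq_existsb => v.
  case uv: (e u v) => //=; congr (_ <= _)%N; apply: eq_card => w; rewrite !inE.
  case vw: (e v w) => //=; rewrite fg // !inE; apply/orP; right.
  by apply/bigcupP; exists v; rewrite inE.
have D0 : (0 < (d + d * d) ^ 2)%N by rewrite expn_gt0 addn_gt0 d_gt0.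
have small u : (#|B u| * (4 * (d + d * d) ^ 2) <= #|{: {ffun V -> A}}|)%N.
  rewrite -(ler_nat R) natrM card_ffun natrX.
  apply: le_trans (_ : #|A|%:R ^+ #|V| * 1 <= _); last by rewrite mulr1.
  apply: le_trans (ler_wpM2l _ num); last by rewrite exprn_ge0.
  rewrite [leRHS]mulrA ler_wpM2r // mulr_natr mulr2n !mulrDr.
  have sub : B u \subset [set f : {ffun V -> A} | (class_deg f u KR <= r)%N] :|:
      [set f : {ffun V -> A} | (class_deg f u KQ <= r)%N] :|:
      [set f : {ffun V -> A} | (l <= #|missing e K y f u|)%N].
    by apply/subsetP => f; rewrite !inE orbA.
  apply: le_trans (_ : (_ + _ + _)%N%:R <= _).
    rewrite ler_nat; apply: leq_trans (subset_leq_card sub) _.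
    apply: leq_trans (leq_card_setU _ _) _.
    by apply: leq_add (leqnn _); exact: leq_card_setU.
  rewrite !natrD !lerD //.
  - by have := class_deg_tail KR u r A0; rewrite cR.
  - by have := class_deg_tail KQ u r A0; rewrite cQ.
  - rewrite [leRHS]mulrA ler_pdivlMr ?exprn_gt0 ?ltr0n //.
    apply: le_trans (missing_moment y K u A0 reg q01).
    by apply: sum_expr_card; rewrite ler1n.
have degree u : (#|[set t | ~~ [disjoint nbh2 u & nbh2 t]]| <= (d + d * d) ^ 2)%N.
  apply: leq_trans (_ : #|\bigcup_(w in nbh2 u) nbh2 w| <= _)%N.
    apply/subset_leq_card/subsetP => t; rewrite inE -setI_eq0 => /set0Pn[w].
    by rewrite inE => /andP[wu wt]; apply/bigcupP; exists w; rewrite // nbh2_sym.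
  apply: leq_trans (card_nbh_bigcup _ card_nbh2) _.
  by rewrite leq_mul2r card_nbh2 orbT.
have /card_gt0P[c0 _] := A0.
have [f hf] := local_lemma dep D0 small degree [ffun=> c0].
exists f => u; have := hf u; rewrite inE !negb_or -!ltnNge.
by case/and3P.
Qed.

(** If [c] is missing at [v], then by symmetry [c] is on the list of every neighbour of [v]. More
    than [r] of these lie in [KQ], and each picks the position of [c] with probability [1 / l]. A
    union bound over the colours and the local lemma with supports [nbh v] finish. *)
Lemma phase_two (A : finType) (K KQ : {set A}) (f : {ffun V -> A}) (r l y : nat) :
  (0 < l)%N ->
  (forall u, (r < class_deg f u KQ)%N) -> (forall u, (#|missing e K y f u| < l)%N) ->
  #|K|%:R * (2 ^+ y * expR (- (r%:R / (2 * l%:R)))) * (4 * (d * d))%:R <= 1 :> R ->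
  exists g : {ffun V -> 'I_l}, forall v c, c \in K -> (colour_deg e f v c <= y)%N ->
    (y < #|[set w | [&& e v w, f w \in KQ, c \in missing e K y f w &
                        index c (enum (missing e K y f w)) == g w]]|)%N.
Proof.
move=> l0 degQ degL num.
pose H v c (w : V) (j : 'I_l) := [&& e v w, f w \in KQ, c \in missing e K y f w &
                        index c (enum (missing e K y f w)) == j].
pose B v := \bigcup_(c in [set c in K | (colour_deg e f v c <= y)%N])
  [set g : {ffun V -> 'I_l} | (hits (H v c) g <= y)%N].
have dep v : depends_on (nbh v) (B v).
  move=> g g' gg; have hE c : hits (H v c) g = hits (H v c) g'.
    apply: eq_card => w; rewrite !inE /H; case vw: (e v w) => //=.
    by rewrite gg // inE.
  by apply/bigcupP/bigcupP => -[c cK]; rewrite inE => hc; exists c; rewrite // inE ?hE // -hE.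
have q01 : 0 < (2^-1 : R) <= 1 by apply/andP; split; lra.
have D0 : (0 < d * d)%N by rewrite muln_gt0 d_gt0.
have card0 : (0 < #|{: 'I_l}|)%N by rewrite card_ord.
have small v : (#|B v| * (4 * (d * d)) <= #|{: {ffun V -> 'I_l}}|)%N.
  rewrite -(ler_nat R) natrM card_ffun natrX.
  apply: le_trans (_ : #|'I_l|%:R ^+ #|V| * 1 <= _); last by rewrite mulr1.
  apply: le_trans (ler_wpM2l _ num); last by rewrite exprn_ge0.
  rewrite [leRHS]mulrA ler_wpM2r // mulrCA.
  set x := _ * (2 ^+ y * _).
  have xge (c : A) : c \in K -> (colour_deg e f v c <= y)%N ->
      #|[set g : {ffun V -> 'I_l} | (hits (H v c) g <= y)%N]|%:R <= x.
    move=> cK cy; have := hits_tail card0 (H v c) y q01.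
    have wr : (r <= weight (H v c))%N.
      apply: leq_trans (ltnW (degQ v)) _; rewrite /class_deg -sum1dep_card big_mkcond.
      apply: leq_sum => w _; case: ifP => // /andP[vw fw].
      have cL : c \in missing e K y f w.
        by rewrite inE cK; apply/existsP; exists v; rewrite symE vw.
      have il : (index c (enum (missing e K y f w)) < l)%N.
        by apply: leq_trans (degL w); rewrite ltnS [X in (_ <= X)%N]cardE index_size.
      by apply/card_gt0P; exists (Ordinal il); rewrite inE /H vw fw cL /=.
    rewrite exprVn ler_pdivrMr ?exprn_gt0 ?ltr0n // => /le_trans; apply.
    rewrite mulrAC -[leLHS]mulrA /x ler_wpM2l ?exprn_ge0 // ler_wpM2l ?exprn_ge0 //.
    rewrite ler_expR lerN2 card_ord invfM mulrA ler_wpM2r ?invr_ge0 ?ler0n //.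
    have -> : 1 - 2^-1 = 2^-1 :> R by lra.
    by rewrite mulrC ler_wpM2l // ?ler_nat // invr_ge0.
  have x0 : 0 <= x by rewrite !mulr_ge0 ?exprn_ge0 ?expR_ge0.
  pose Bc c := [set g : {ffun V -> 'I_l} | (colour_deg e f v c <= y) && (hits (H v c) g <= y)]%N.
  apply: le_trans (_ : (\sum_(c in K) #|Bc c|)%N%:R <= _).
    rewrite ler_nat; apply: leq_trans (_ : #|\bigcup_(c in K) Bc c| <= _)%N.
      apply/subset_leq_card/subsetP => g /bigcupP[c]; rewrite !inE => /andP[cK cy] hg.
      by apply/bigcupP; exists c; rewrite // inE cy.
    elim/big_ind2: _ => [|x1 x2 y1 y2 h1 h2|c _]; rewrite ?cards0 //.
    by apply: leq_trans (leq_card_setU _ _) (leq_add h1 h2).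
  rewrite natr_sum mulr_natl -sumr_const; apply: ler_sum => c cK.
  rewrite /Bc; have [cy|cy] := boolP (colour_deg e f v c <= y)%N; first exact: xge.
  by rewrite (_ : [set g | _] = set0) ?cards0 //; apply/setP => g; rewrite !inE.
have degree u : (#|[set t | ~~ [disjoint nbh u & nbh t]]| <= d * d)%N.
  apply: leq_trans (_ : #|\bigcup_(w in nbh u) nbh w| <= _)%N.
    apply/subset_leq_card/subsetP => t; rewrite inE -setI_eq0 => /set0Pn[w].
    by rewrite !inE => /andP[uw tw]; apply/bigcupP; exists w; rewrite inE // symE.
  apply: leq_trans (card_nbh_bigcup _ (b := d) _) _; first by move=> v; rewrite reg.
  by rewrite reg.
have [g hg] := local_lemma dep D0 small degree [ffun=> Ordinal l0].
exists g => v c cK cy; rewrite ltnNge; apply: contra (hg v) => hc.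
by apply/bigcupP; exists c; rewrite inE // cK.
Qed.

Lemma card_ord_interval (N a b : nat) : (b <= N)%N ->
  #|[set c : 'I_N | (a <= c < b)%N]| = (b - a)%N.
Proof.
move=> bN; have lt (j : 'I_(b - a)) : (a + j < N)%N.
  by apply: leq_trans bN; rewrite -ltn_subRL.
rewrite -[RHS]card_ord -(card_imset _ (f := fun j => Ordinal (lt j))); last first.
  by move=> j j' [/addnI/val_inj].
apply: eq_card => c; rewrite inE; apply/idP/imsetP => [/andP[ac cb]|[j _ ->]] /=.
  have cab : (c - a < b - a)%N by rewrite ltn_sub2r // (leq_ltn_trans ac).
  by exists (Ordinal cab) => //; apply: val_inj; rewrite /= subnKC.
by rewrite leq_addr -ltn_subRL ltn_ord.
Qed.

(** Vertices coloured in [K] keep their colour, those in [KR] are merged into the single reserve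
    [k], and those in [KQ] take the colour picked from their list. A class already frequent at [v]
    thus stays so, and one missing at [v] is repaired. *)
Lemma two_phase (N k a r l y : nat) (q : R) :
  (0 < N)%N -> (k + a + a <= N)%N -> (0 < l)%N -> 0 < q <= 1 ->
  (2 ^+ r * expR (- (d%:R * a%:R / (2 * N%:R))) * 2
   + (1 + d%:R * (q ^- y * expR (- ((1 - q) * d%:R / N%:R)))) ^+ k / 2 ^+ l)
    * (4 * (d + d * d) ^ 2)%:R <= 1 ->
  k%:R * (2 ^+ y * expR (- (r%:R / (2 * l%:R)))) * (4 * (d * d))%:R <= 1 :> R ->
  exists h : V -> nat,
    (forall v i, (i < k)%N -> (y < #|[set w | e v w && (h w == i)]|)%N) /\
    (forall v, (r < #|[set w | e v w && (h w == k)]|)%N).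
Proof.
move=> N0 kaN l0 q01 num1 num2.
pose K := [set c : 'I_N | (0 <= c < k)%N].
pose KR := [set c : 'I_N | (k <= c < k + a)%N].
pose KQ := [set c : 'I_N | (k + a <= c < k + a + a)%N].
have cK : #|K| = k by rewrite card_ord_interval ?subn0 // (leq_trans _ kaN) // -addnA leq_addr.
have cR : #|KR| = a by rewrite card_ord_interval ?addKn // (leq_trans _ kaN) // leq_addr.
have cQ : #|KQ| = a by rewrite card_ord_interval ?addKn.
have [||f hf] := @phase_one 'I_N K KR KQ a r l y q _ cR cQ q01; rewrite ?card_ord ?cK //.
have [|||g hg] := @phase_two 'I_N K KQ f r l y l0; rewrite ?cK //.
- by move=> u; have [] := hf u.
- by move=> u; have [] := hf u.
(* The value [k.+1] discards a vertex, in particular when the position [g w] lies beyond the end of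
   its list. *)
pose h w := if f w \in K then (f w : nat) else if f w \in KR then k else
  if f w \in KQ then nth k.+1 [seq val c | c <- enum (missing e K y f w)] (g w) else k.+1.
exists h; split=> [v i ik|v].
  have iN : (i < N)%N by apply: leq_trans ik _; rewrite (leq_trans _ kaN) // -addnA leq_addr.
  pose c := Ordinal iN; have cinK : c \in K by rewrite inE.
  have [cy|cy] := leqP (colour_deg e f v c) y; last first.
    apply: leq_trans cy _; apply/subset_leq_card/subsetP => w; rewrite !inE.
    by case/andP=> -> /eqP fw; rewrite /h fw cinK /=.
  apply: leq_trans (hg v c cinK cy) _; apply/subset_leq_card/subsetP => w; rewrite !inE.
  case/and4P => -> fQ cM /eqP ig; rewrite /h !inE /=.
  have [kf fk] := andP fQ.
  have nK : (f w < k)%N = false by rewrite ltnNge (leq_trans (leq_addr a k) kf).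
  have nR : (f w < k + a)%N = false by rewrite ltnNge kf.
  rewrite nK nR andbF fQ.
  rewrite -ig (nth_map c) ?index_mem ?mem_enum ?inE ?cM //.
  by case/andP: cM => _ cM; rewrite nth_index // mem_enum inE cinK.
have [hR _ _] := hf v; apply: leq_trans hR _.
apply/subset_leq_card/subsetP => w; rewrite !inE => /andP[-> /= /andP[kf fk]].
by rewrite /h !inE /= ltnNge kf fk /= eqxx.
Qed.
End Colouring.

(** * Numerical estimates for the colouring *)

Section Numerics.
Variable R : realType.
Implicit Types x y eps : R.

Lemma expR_ge_sqr x : 0 <= x -> x ^+ 2 / 2 <= expR x.
Proof.
move=> x0; apply: le_trans (expR_ge1Dxn 1 x0); rewrite -[leLHS]add0r lerD //.
Qed.

Lemma pow2_le_expR (n : nat) : 2 ^+ n <= expR n%:R :> R.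
Proof.
rewrite -[n%:R]mulr1 expRM_natl lerXn2r ?nnegrE ?expR_ge0 //.
exact: expR_ge1Dx.
Qed.

Lemma pow2_ge_expR (n : nat) : expR (n%:R / 2) <= 2 ^+ n :> R.
Proof.
rewrite expRM_natl lerXn2r ?nnegrE ?expR_ge0 //.
have h : (2 : R)^-1 <= expR (- 2^-1) by apply: le_trans (expR_ge1Dx _); lra.
by rewrite expRN lef_pV2 ?posrE ?expR_gt0 // in h.
Qed.

(* With L = ln d, the moments above are taken at q = eps / 8, and the lists of missing colours have
   size at most l, about 4 d^(1 - eps / 8). The bound on L comes from the second phase, where
   eps / 64 * (L * eps / 8)^2 / 2 has to exceed 80 L. *)
Section Constants.
Variables (eps L : R) (d : nat).
Hypotheses (e0 : 0 < eps) (e1 : eps <= 2^-1) (Ld : d%:R = expR L)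
  (Lbig : 64 * 64 * 160 <= L * eps ^+ 3).

Let L_ge : 64 * 64 * 160 <= L.
Proof.
have e3 : eps ^+ 3 <= 1 by rewrite exprn_ile1 // ?ltW //; move: e1; lra.
apply: le_trans Lbig _; rewrite ler_piMr //.
have e30 : 0 < eps ^+ 3 by rewrite exprn_gt0.
have : 0 < L * eps ^+ 3 by move: Lbig; lra.
by rewrite pmulr_lgt0 // => /ltW.
Qed.

Let Leps : 160 * 2 <= L * eps.
Proof.
have e2 : eps ^+ 2 <= 1 by rewrite exprn_ile1 // ?ltW //; move: e1; lra.
have L0 : 0 <= L * eps by rewrite mulr_ge0 ?(ltW e0) //; move: L_ge; lra.
have : L * eps ^+ 3 <= L * eps by rewrite exprS mulrA ler_piMr.
by move: Lbig; lra.
Qed.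

Let d_ge : L * L / 2 <= d%:R.
Proof. by rewrite Ld -expr2; apply: expR_ge_sqr; move: L_ge; lra. Qed.

Let L0 : 0 < L. Proof. by move: L_ge; lra. Qed.
Local Notation x := (d%:R : R).
Let x0 : 0 < x. Proof. by rewrite Ld expR_gt0. Qed.
Let eL0 : 0 < L * eps. Proof. by rewrite mulr_gt0. Qed.

Let x48 : 48 <= x.
Proof. by apply: le_trans d_ge; move: L_ge; nra. Qed.

(** The factor is [160 = 32 * 5]: in [degree_term], [eps * x / 32] has to exceed [5 * L]. *)
Let epsx : 320 / 2 * L <= eps * x.
Proof.
have : eps * (L * L / 2) <= eps * x by rewrite ler_pM2l.
have : 160 * 2 * L <= L * eps * L by rewrite ler_pM2r.
lra.
Qed.

Let x5 : expR (- (5 * L)) * x ^+ 5 = 1.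
Proof. by rewrite Ld -expRM_natl -expRD addNr expR0. Qed.

(** The exponent [5] beats the number of dependent events, which is of order [x ^+ 4] in the first
    phase, with a factor [x] to spare. *)
Let le_x5 z : 5 * L <= z -> expR (- z) <= x ^- 5.
Proof.
move=> h; rewrite -[leRHS]mul1r -[X in X * _]x5 mulfK ?expf_neq0 ?gt_eqF //.
by rewrite ler_expR lerN2.
Qed.

Variables (k a N r l y : nat).
Let u := x / L.
Let B := expR (L - L * eps / 8).
Hypotheses (hk : k = (Num.truncn ((1 - eps) * u)).+1)
  (ha : a = (Num.truncn (eps / 8 * u)).+1) (hN : N = (k + a + a)%N)
  (hr : r = Num.truncn (eps / 32 * x)) (hy : y = Num.truncn (eps ^+ 2 / 64 * L))
  (hl : l = (Num.truncn (4 * B)).+1).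

Let u0 : 0 < u. Proof. by rewrite divr_gt0. Qed.
Let xE : x = u * L. Proof. by rewrite divfK // gt_eqF. Qed.

Let epsu : 160 <= eps * u.
Proof. by rewrite -(ler_pM2r L0) -mulrA -xE; move: epsx; lra. Qed.

Let k_le : k%:R <= (1 - eps) * u + 1.
Proof.
rewrite hk -addn1 natrD lerD2r.
have /truncn_itv/andP[] // : 0 <= (1 - eps) * u by rewrite mulr_ge0 ?(ltW u0) //; move: e1; lra.
Qed.

Lemma k_ge : (1 - eps) * u <= k%:R.
Proof.
rewrite hk.
have /truncn_itv/andP[_ /ltW] // : 0 <= (1 - eps) * u by rewrite mulr_ge0 ?(ltW u0) //; move: e1; lra.
Qed.

Let a_bnd : eps / 8 * u <= a%:R <= eps / 8 * u + 1.
Proof.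
have /truncn_itv/andP[h1 /ltW h2] : 0 <= eps / 8 * u by rewrite mulr_ge0 ?(ltW u0) // divr_ge0 ?(ltW e0).
by rewrite ha h2 /= -addn1 natrD lerD2r.
Qed.

(** The two halves of the reserve take about [eps / 4 * u] of the [eps * u] colours that are saved.
    The remaining slack gives [(1 + eps / 4) * L * N <= (1 - eps / 8) * x] in [missing_term]. *)
Let N_le : N%:R <= (1 - eps / 2) * u.
Proof. by rewrite hN !natrD; move: k_le epsu; case/andP: a_bnd; lra. Qed.

Let N_le_u : N%:R <= u.
Proof. by apply: le_trans N_le _; rewrite ler_piMl ?(ltW u0) //; move: e0; lra. Qed.

Let N_gt0 : 0 < N%:R :> R.
Proof. by rewrite ltr0n hN hk. Qed.

Let u_le_x : u <= x.
Proof. by rewrite ler_pdivrMr // ler_peMr ?(ltW x0) //; move: L_ge; lra. Qed.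

Lemma k_le_d : (k <= d)%N.
Proof.
rewrite -(ler_nat R); apply: le_trans u_le_x; apply: le_trans N_le_u.
by rewrite ler_nat hN -addnA leq_addr.
Qed.
Let k_le_x : k%:R <= x. Proof. by rewrite ler_nat k_le_d. Qed.

Let r_bnd : r%:R <= eps / 32 * x < r%:R + 1.
Proof. by rewrite hr natr1; apply: truncn_itv; rewrite mulr_ge0 ?divr_ge0 ?(ltW e0). Qed.

Let y_bnd : y%:R <= eps ^+ 2 / 64 * L.
Proof.
rewrite hy; have /truncn_itv/andP[] // : 0 <= eps ^+ 2 / 64 * L.
by rewrite mulr_ge0 ?divr_ge0 ?(ltW L0) // exprn_ge0 // ltW.
Qed.

Let B0 : 0 < B. Proof. exact: expR_gt0. Qed.

Let B5 : 5 * L <= B.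
Proof.
apply: le_trans (_ : (L / 2) ^+ 2 / 2 <= _); first by move: L_ge; nra.
apply: le_trans (expR_ge_sqr _) _; first by rewrite divr_ge0 ?ltW.
by rewrite ler_expR; move: L0 e1; nra.
Qed.

Let l_bnd : 4 * B <= l%:R <= 4 * B + 1.
Proof.
have /truncn_itv/andP[h1 /ltW h2] : 0 <= 4 * B by rewrite mulr_ge0 ?(ltW B0).
by rewrite hl h2 /= -addn1 natrD lerD2r.
Qed.

(** A vertex has on average at least [eps / 8 * x] neighbours in one half of the reserve. The
    exponent [eps * x / 16] of the tail then outweighs [r <= eps / 32 * x]. *)
Lemma degree_term : 2 ^+ r * expR (- (x * a%:R / (2 * N%:R))) <= x ^- 5 :> R.
Proof.
apply: le_trans (ler_wpM2r (expR_ge0 _) (pow2_le_expR r)) _.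
rewrite -expRD -[r%:R + _]opprK; apply: le_x5; rewrite opprD opprK.
have : eps * x / 16 <= x * a%:R / (2 * N%:R).
  rewrite ler_pdivlMr ?mulr_gt0 //; have /andP[ha1 _] := a_bnd.
  have : x * (eps / 8 * N%:R) <= x * a%:R.
    rewrite ler_pM2l //; apply: le_trans ha1; rewrite ler_pM2l // divr_gt0 //.
  lra.
by case/andP: r_bnd; move: epsx; lra.
Qed.

(** A single colour contributes [x * t], at most [d ^ (- eps / 8)], so all [k] of them give at most
    [expR B]. As [l >= 4 * B], the denominator [2 ^+ l] is at least [expR (2 * B)]. *)
Lemma missing_term :
  (1 + x * ((eps / 8) ^- y * expR (- ((1 - eps / 8) * x / N%:R)))) ^+ k / 2 ^+ l
  <= x ^- 5 :> R.
Proof.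
set t := _ ^- y * _.
have q0 : 0 < eps / 8 by rewrite divr_gt0.
have t0 : 0 <= t by rewrite mulr_ge0 ?expR_ge0 // invr_ge0 exprn_ge0 // ltW.
(* Since [8 / eps <= expR (8 / eps)], the power [y <= eps ^+ 2 / 64 * L] costs a factor of at most
   [d ^ (eps / 8)]. *)
have qy : (eps / 8) ^- y <= expR (L * eps / 8).
  rewrite -exprVn invf_div; apply: le_trans (_ : expR (8 / eps) ^+ y <= _).
    rewrite lerXn2r ?nnegrE ?expR_ge0 ?divr_ge0 ?(ltW e0) //.
    by apply: le_trans (expR_ge1Dx _); rewrite lerDr.
  rewrite -expRM_natl ler_expR mulrA ler_pdivrMr //.
  by move: y_bnd; nra.
have xt : x * t <= expR (- (L * eps / 8)).
  apply: le_trans (_ : expR L * (expR (L * eps / 8) * expR (- ((1 + eps / 4) * L))) <= _).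
    rewrite -Ld ler_pM2l // ler_pM ?expR_ge0 //.
      by rewrite invr_ge0 exprn_ge0 // ltW.
    rewrite ler_expR lerN2 ler_pdivlMr //.
    have : (1 + eps / 4) * L * N%:R <= (1 + eps / 4) * L * ((1 - eps / 2) * u).
      by rewrite ler_pM2l // mulr_gt0 //; move: e0; lra.
    move/le_trans; apply.
    have -> : (1 + eps / 4) * L * ((1 - eps / 2) * u) = (1 + eps / 4) * (1 - eps / 2) * x.
      by rewrite xE; ring.
    by rewrite ler_pM2r //; move: e0; nra.
  by rewrite -!expRD ler_expR; lra.
have kxt : (1 + x * t) ^+ k <= expR B.
  apply: le_trans (_ : expR (x * t) ^+ k <= _).
    rewrite lerXn2r ?nnegrE ?expR_ge0 ?expR_ge1Dx //.
    by rewrite addr_ge0 // mulr_ge0 // ltW.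
  rewrite -expRM_natl ler_expR /B expRD -Ld ler_pM //.
  by rewrite mulr_ge0 // ltW.
rewrite ler_pdivrMr ?exprn_gt0 //; apply: le_trans kxt _.
apply: le_trans (_ : expR (- B) * expR (l%:R / 2) <= _).
  by rewrite -expRD ler_expR; case/andP: l_bnd; lra.
by apply: ler_pM; rewrite ?expR_ge0 ?pow2_ge_expR ?le_x5.
Qed.

Lemma numeric1 :
  (2 ^+ r * expR (- (x * a%:R / (2 * N%:R))) * 2
   + (1 + x * ((eps / 8) ^- y * expR (- ((1 - eps / 8) * x / N%:R)))) ^+ k / 2 ^+ l)
    * (4 * (d + d * d) ^ 2)%:R <= 1 :> R.
Proof.
have x1 : 1 <= x by move: x48; lra.
apply: le_trans (_ : (x ^- 5 * 2 + x ^- 5) * (16 * x ^+ 4) <= _).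
  have h0 : 0 <= x ^- 5 by rewrite invr_ge0 exprn_ge0 // ltW.
  apply: ler_pM.
  - apply: addr_ge0; first by rewrite !mulr_ge0 ?expR_ge0 ?exprn_ge0.
    apply: divr_ge0; rewrite exprn_ge0 // addr_ge0 // mulr_ge0 ?(ltW x0) //.
    by rewrite mulr_ge0 ?expR_ge0 // invr_ge0 exprn_ge0 // divr_ge0 // ltW.
  - exact: ler0n.
  - by rewrite lerD ?missing_term // ler_pM2r ?degree_term.
  - rewrite natrM natrX natrD natrM -[leLHS]/(4%:R * _).
    have : (x + x * x) ^+ 2 <= (2 * x ^+ 2) ^+ 2.
      rewrite lerXn2r ?nnegrE ?addr_ge0 ?mulr_ge0 ?exprn_ge0 ?(ltW x0) //.
      by rewrite expr2; move: x1; nra.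
    by rewrite exprMn -exprM; lra.
have -> : (x ^- 5 * 2 + x ^- 5) * (16 * x ^+ 4) = 48 / x.
  have xn : x != 0 by rewrite gt_eqF.
  by field.
by rewrite ler_pdivrMr // mul1r.
Qed.

(** [r / l] is of order [eps * d ^ (eps / 8)], large enough for the bound [x ^- 5]. This outweighs
    the at most [x] colours, the factor [2 ^+ y <= x] and the degree [d * d]. *)
Lemma numeric2 :
  k%:R * (2 ^+ y * expR (- (r%:R / (2 * l%:R)))) * (4 * (d * d))%:R <= 1 :> R.
Proof.
have x1 : 1 <= x by move: x48; lra.
have y2 : 2 ^+ y <= x :> R.
  rewrite Ld; apply: le_trans (pow2_le_expR y) _; rewrite ler_expR.
  apply: le_trans y_bnd _; rewrite ler_piMl ?(ltW L0) // ler_pdivrMr // mul1r.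
  by move: e0 e1; nra.
have rl : expR (- (r%:R / (2 * l%:R))) <= x ^- 5.
  have [l1 l2] := andP l_bnd; have [_ r2] := andP r_bnd.
  have l8 : l%:R <= 8 * B by move: B5 L_ge l2; lra.
  have lpos : 0 < l%:R :> R by rewrite ltr0n hl.
  apply: le_x5; rewrite ler_pdivlMr ?mulr_gt0 //.
  apply: le_trans (_ : 5 * L * (2 * (8 * B)) <= _).
    by rewrite ler_pM2l ?ler_pM2l // mulr_gt0.
  apply: le_trans (_ : eps / 64 * x <= _); last by move: epsx L_ge r2; lra.
  have xB : x = expR (L * eps / 8) * B.
    by rewrite Ld -expRD; congr expR; ring.
  have : (L * eps / 8) ^+ 2 / 2 <= expR (L * eps / 8).
    by apply: expR_ge_sqr; rewrite divr_ge0 // ltW.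
  rewrite xB => h; rewrite [leLHS]mulrA [_ * (8 * B)]mulrA [leRHS]mulrA ler_pM2r //.
  apply: le_trans (_ : eps / 64 * ((L * eps / 8) ^+ 2 / 2) <= _); last first.
    by rewrite ler_pM2l // divr_gt0.
  have : 64 * 64 * 160 * L <= L * eps ^+ 3 * L by rewrite ler_pM2r.
  have -> : eps / 64 * ((L * eps / 8) ^+ 2 / 2) = L * eps ^+ 3 * L / (64 * 128) by field.
  lra.
apply: le_trans (_ : x * (x * x ^- 5) * (4 * (x * x)) <= _).
  rewrite !natrM ler_pM ?ler_pM ?mulr_ge0 ?expR_ge0 ?exprn_ge0 ?(ltW x0) //.
have -> : x * (x * x ^- 5) * (4 * (x * x)) = 4 / x.
  have xn : x != 0 by rewrite gt_eqF.
  by field.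
by rewrite ler_pdivrMr // mul1r; move: x48; lra.
Qed.
End Constants.
End Numerics.

Lemma domatic_colouring (R : realType) (eps : R) (V : finType) (e : rel V) (d : nat) :
  0 < eps -> eps <= 2^-1 -> symmetric e -> regular e d ->
  64 * 64 * 160 <= ln d%:R * eps ^+ 3 ->
  exists k (h : V -> nat),
    [/\ (1 - eps) * (d%:R / ln d%:R) <= k%:R, (k <= d)%N,
       forall v i, (i < k)%N -> eps ^+ 2 / 64 * ln d%:R <= #|[set w | e v w && (h w == i)]|%:R &
       forall v, eps / 32 * d%:R <= #|[set w | e v w && (h w == k)]|%:R].
Proof.
move=> e0 e1 symE reg Lbig; set L := ln d%:R in Lbig *.
have d0 : (0 < d)%N.
  rewrite lt0n; apply: contraTneq Lbig => dE; rewrite /L dE ln0 // mul0r -ltNge.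
  by lra.
have Ld : d%:R = expR L :> R by rewrite lnK // posrE ltr0n.
have q01 : 0 < eps / 8 <= 1 by apply/andP; split; lra.
have ex (n : nat) : {m | m = n} by exists n.
have [k hk] := ex (Num.truncn ((1 - eps) * (d%:R / L))).+1.
have [a ha] := ex (Num.truncn (eps / 8 * (d%:R / L))).+1.
have [N hN] := ex (k + a + a)%N.
have [r hr] := ex (Num.truncn (eps / 32 * d%:R)).
have [y hy] := ex (Num.truncn (eps ^+ 2 / 64 * L)).
have [l hl] := ex (Num.truncn (4 * expR (L - L * eps / 8))).+1.
have n1 := numeric1 e0 e1 Ld Lbig hk ha hN hr hy hl.
have n2 := numeric2 e0 e1 Ld Lbig hk ha hN hr hy hl.
have N0 : (0 < N)%N by rewrite hN hk.
have l0 : (0 < l)%N by rewrite hl.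
have kN : (k + a + a <= N)%N by rewrite hN.
have [h [hD hR]] := two_phase symE reg d0 N0 kN l0 q01 n1 n2.
have L0 : 0 < L.
  have e3 : 0 < eps ^+ 3 by rewrite exprn_gt0.
  by rewrite -(pmulr_lgt0 _ e3); lra.
exists k, h; split.
- exact: (k_ge e0 e1 Ld Lbig hk).
- exact: (k_le_d e0 e1 Ld Lbig hk ha hN).
- move=> v i /(hD v); rewrite hy -(ler_nat R); apply: le_trans.
  have /truncn_itv/andP[_ /ltW] // : 0 <= eps ^+ 2 / 64 * L.
  by rewrite mulr_ge0 ?divr_ge0 ?(ltW L0) // exprn_ge0 // ltW.
- move=> v; have := hR v; rewrite hr -(ler_nat R); apply: le_trans.
  have /truncn_itv/andP[_ /ltW] // : 0 <= eps / 32 * d%:R.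
  by rewrite mulr_ge0 ?divr_ge0 ?(ltW e0).
Qed.

(** * The expander mixing lemma *)

Lemma char_poly_conj (F : fieldType) (n : nat) (P D : 'M[F]_n) :
  P \in unitmx -> char_poly (invmx P *m D *m P) = char_poly D.
Proof.
move=> Pu; rewrite /char_poly /char_poly_mx !map_mxM /=.
have PU : map_mx polyC (invmx P) *m map_mx polyC P = 1%:M.
  by rewrite -map_mxM /= mulVmx // map_mx1.
have {1}-> : 'X%:M = map_mx polyC (invmx P) *m 'X%:M *m map_mx polyC P.
  by rewrite mul_mx_scalar -scalemxAl PU scale_scalar_mx mulr1.
rewrite -mulmxBl -mulmxBr !det_mulmx mulrAC -det_mulmx PU.
by rewrite det1 mul1r.
Qed.

Section NormalForm.
Variables (C : numClosedFieldType) (n : nat) (A : 'M[C]_n).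
Hypothesis nA : A \is normalmx.
Local Notation P := (spectralmx A).
Local Notation D := (spectral_diag A).

Let AE : A = invmx P *m diag_mx D *m P.
Proof. exact/orthomx_spectralP. Qed.

Lemma char_poly_normal : char_poly A = \prod_(i < n) ('X - (D 0 i)%:P).
Proof.
rewrite {1}AE char_poly_conj ?spectral_unit //.
rewrite char_poly_trig ?diag_mx_is_trig //.
by apply: eq_bigr => i _; rewrite mxE eqxx.
Qed.

Local Open Scope sesquilinear_scope.

Lemma dotmx_sum (u v : 'rV[C]_n) :
  dotmx u v = \sum_i u 0 i * (v 0 i)^*.
Proof. by rewrite dotmxE mxE; apply: eq_bigr => i _; rewrite !mxE. Qed.

Lemma dotmx_unitary (x y : 'rV[C]_n) :
  dotmx (x *m P^t*) (y *m P^t*) = dotmx x y.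
Proof.
rewrite !dotmxE trmx_mul map_mxM trmxCK mulmxA.
by rewrite mulmxKtV // spectral_unitarymx.
Qed.

(** In an orthonormal eigenbasis [A] acts on [x] with factors of modulus at most [lam], as the other
    coordinates of [x] vanish; Cauchy-Schwarz does the rest. *)
Lemma normal_form_bound (lam : C) (x y : 'rV[C]_n) : 0 <= lam ->
  (forall j, (x *m P^t*) 0 j = 0 \/ `|D 0 j| <= lam) ->
  `|dotmx (x *m A) y| ^+ 2 <= lam ^+ 2 * (dotmx x x * dotmx y y).
Proof.
move=> lam0 hx; set u := x *m P^t*.
have -> : dotmx (x *m A) y = dotmx (u *m diag_mx D) (y *m P^t*).
  rewrite !dotmxE trmx_mul map_mxM trmxCK.
  rewrite {1}AE invmx_unitary ?spectral_unitarymx //.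
  by rewrite !mulmxA.
have CS (a b : 'rV[C]_n) : `|dotmx a b| ^+ 2 <= dotmx a a * dotmx b b :> C.
  exact: (CauchySchwarz (@dotmx C n) a b).1.
apply: le_trans (CS _ _) _.
rewrite dotmx_unitary mulrA ler_wpM2r //.
  by rewrite dotmx_sum sumr_ge0 // => i _; rewrite -normCK exprn_ge0.
rewrite -(dotmx_unitary x x) -/u !dotmx_sum mulr_sumr; apply: ler_sum => j _.
have -> : (u *m diag_mx D) 0 j = u 0 j * D 0 j by rewrite mul_mx_diag mxE.
rewrite -!normCK normrM exprMn mulrC.
case: (hx j) => [uj0|hj]; first by rewrite /u uj0 normr0 expr0n !mulr0.
by rewrite ler_wpM2r ?exprn_ge0 // lerXn2r ?nnegrE.
Qed.
End NormalForm.

Section Mixing.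
Variables (R : rcfType) (n : nat) (A : 'M[R]_n) (s : n.-tuple R).
Hypothesis n_gt0 : (0 < n)%N.
Variables (d lam : R).
Hypothesis symA : A^T = A.
Hypothesis charA : char_poly A = \prod_(x <- s) ('X - x%:P).
Hypothesis lam0 : 0 <= lam.
Hypothesis slam : forall j : nat, (0 < j < n)%N -> `|s`_j| <= lam.
Hypothesis lamd : lam < d.
Hypothesis regA : const_mx 1 *m A = d *: const_mx 1 :> 'rV_n.

Local Open Scope sesquilinear_scope.
Local Notation toC := (map_mx (real_complex R)).
Local Notation dot u v := ((u *m v^T) 0 0).

(** The matrix is diagonalised over the complex numbers. The all-ones vector lives only on
    coordinates with eigenvalue [d > lam], and there is at most one of these, so a vector orthogonal
    to it has a zero there. *)
Lemma real_form_bound (x y : 'rV[R]_n) :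
  dot x (const_mx 1 : 'rV[R]_n) = 0 ->
  (dot (x *m A) y) ^+ 2 <= lam ^+ 2 * (dot x x * dot y y).
Proof.
move=> x1.
have dotC (u v : 'rV[R]_n) : dotmx (toC u) (toC v) = ((dot u v)%:C)%C.
  rewrite dotmx_sum mxE rmorph_sum; apply: eq_bigr => i _ /=.
  by rewrite !mxE rmorphM /= conj_Creal // complex_real.
have nA : toC A \is normalmx.
  apply: symmetric_normalmx.
    by apply/is_hermitianmxP; rewrite expr0 scale1r map_mx_id // map_trmx symA.
  by apply/mxOverP => i j; rewrite mxE complex_real.
set P := spectralmx (toC A); set D := spectral_diag (toC A).
have permD : perm_eq [seq D 0 i | i : 'I_n] [seq (x%:C)%C | x <- s].
  apply: prod_XsubC_eq; rewrite big_map big_enum /= -char_poly_normal //.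
  rewrite -map_char_poly charA rmorph_prod big_map /=.
  by apply: eq_bigr => z _; rewrite rmorphB /= map_polyX map_polyC.
(* The diagonal is a permutation of [s], in which only the head can exceed [lam] in modulus. *)
have one_big i j : lam%:C%C < `|D 0 i| -> lam%:C%C < `|D 0 j| -> i = j.
  move=> hi hj; pose p := [pred z : R[i] | lam%:C%C < `|z|].
  have : (count p [seq D 0%R i | i : 'I_n] <= 1)%N.
    rewrite (permP permD) count_map.
    have -> : tval s = s`_0 :: behead s.
      by move: (size_tuple s) n_gt0; case: (tval s) => [<-|].
    rewrite -cat1s count_cat [X in (_ + X)%N](_ : _ = 0)%N ?addn0 ?count_size //.
    apply/eqP; rewrite -leqn0 leqNgt -has_count.
    apply/hasPn => z /(nthP 0) [k].
    rewrite size_behead size_tuple /= => kn <-.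
    rewrite nth_behead normc_def /= expr0n addr0 sqrtr_sqr ltcR -leNgt.
    by rewrite slam // -ltn_predRL.
  rewrite count_map -sum1_count big_enum_cond sum1_card => /card_le1_eqP; apply.
    exact: hj.
  exact: hi.
set w : 'rV[R]_n := const_mx 1.
set u := toC x *m P^t*; set v := toC w *m P^t*.
have AE : toC A = invmx P *m diag_mx D *m P by exact/orthomx_spectralP.
have vD j : v 0 j * D 0 j = d%:C%C * v 0 j.
  have : v *m diag_mx D = d%:C%C *: v.
    rewrite /v scalemxAl -map_mxZ -regA map_mxM AE invmx_unitary ?spectral_unitarymx //.
    by rewrite !mulmxA mulmxtVK ?spectral_unitarymx.
  by move=> /rowP/(_ j); rewrite mul_mx_diag !mxE.
have v0 j : `|D 0 j| <= lam%:C%C -> v 0 j = 0.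
  move=> Dj; apply/eqP; case: eqP => // /eqP vn0; move: (vD j); rewrite mulrC.
  move/(mulIf vn0) => Dd; move: Dj; rewrite Dd normc_def /= expr0n addr0 sqrtr_sqr.
  by rewrite lecR ger0_norm ?(ltW (le_lt_trans lam0 lamd)) // leNgt lamd.
have : `|dotmx (toC x *m toC A) (toC y)| ^+ 2 <=
    lam%:C%C ^+ 2 * (dotmx (toC x) (toC x) * dotmx (toC y) (toC y)).
  apply: normal_form_bound => //; first by rewrite lecR.
  move=> j; rewrite -/u.
  case: (boolP (`|D 0 j| <= lam%:C%C)) => Dj; [by right | left].
  have {}Dj : lam%:C%C < `|D 0 j| by rewrite real_ltNge ?normr_real ?complex_real.
  have : dotmx u v = 0 by rewrite dotmx_unitary dotC x1.
  rewrite dotmx_sum (bigD1 j) //= big1 => [|i ij]; last first.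
    rewrite v0 ?conjC0 ?mulr0 //; apply: contraNT ij => Di.
    by apply/eqP/one_big; rewrite // real_ltNge ?normr_real ?complex_real.
  rewrite addr0 => /eqP; rewrite mulf_eq0 conjC_eq0 => /orP[/eqP-> // | /eqP vj].
  (* If instead [v 0 j = 0], then all of [v] vanishes, although its squared norm is [n]. *)
  have : dotmx v v = 0.
    rewrite dotmx_sum big1 // => i _; case: (eqVneq i j) => [->|ij].
      by rewrite vj mul0r.
    rewrite v0 ?mul0r //; apply: contraNT ij => Di.
    by apply/eqP/one_big; rewrite // real_ltNge ?normr_real ?complex_real.
  rewrite dotmx_unitary dotC => /complexI; rewrite mxE.
  rewrite (eq_bigr (fun=> 1)) => [|i _]; last by rewrite !mxE mulr1.
  by rewrite sumr_const card_ord => /eqP; rewrite pnatr_eq0 -leqn0 leqNgt n_gt0.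
have normsq (z : R) : `|z%:C%C| ^+ 2 = (z ^+ 2)%:C%C.
  by rewrite normc_def /= expr0n addr0 sqrtr_sqr -rmorphXn /= real_normK ?num_real.
by rewrite -map_mxM !dotC normsq -rmorphXn -!rmorphM lecR.
Qed.

(** Subtracting from [x] its projection on the all-ones vector removes the main term [d * ... / n]
    and does not increase the norm. *)
Lemma real_mixing (x y : 'rV[R]_n) :
  (dot (x *m A) y - d * (\sum_i x 0 i) * (\sum_i y 0 i) / n%:R) ^+ 2
  <= lam ^+ 2 * (dot x x * dot y y).
Proof.
have dE (u v : 'rV[R]_n) : dot u v = \sum_i u 0 i * v 0 i.
  by rewrite mxE; apply: eq_bigr => i _; rewrite mxE.
have n0 : n%:R != 0 :> R by rewrite pnatr_eq0 -lt0n.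
set a := \sum_i x 0 i; set w : 'rV[R]_n := const_mx 1.
have dw (u : 'rV[R]_n) : dot u w = \sum_i u 0 i.
  by rewrite dE; apply: eq_bigr => i _; rewrite mxE mulr1.
have dwl (u : 'rV[R]_n) : dot w u = \sum_i u 0 i.
  by rewrite dE; apply: eq_bigr => i _; rewrite mxE mul1r.
have ww : dot w w = n%:R.
  by rewrite dw (eq_bigr (fun=> 1)) ?sumr_const ?card_ord // => i _; rewrite mxE.
have dB (u v z : 'rV[R]_n) c : dot (u - c *: v) z = dot u z - c * dot v z.
  by rewrite mulmxBl -scalemxAl !mxE.
pose x' := x - (a / n%:R) *: w.
have x'w : dot x' w = 0 by rewrite dB ww dw divfK // subrr.
have := real_form_bound y x'w.
rewrite mulmxBl -scalemxAl regA scalerA dB dwl.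
rewrite (_ : a / n%:R * d * _ = d * a * (\sum_i y 0 i) / n%:R); last first.
  by rewrite [a / _ * d]mulrAC [a * d]mulrC mulrAC.
move/le_trans; apply; rewrite ler_wpM2l ?sqr_ge0 // ler_wpM2r //.
  by rewrite dE sumr_ge0 // => i _; rewrite -expr2 sqr_ge0.
have symdot (u v : 'rV[R]_n) : dot u v = dot v u.
  by rewrite !dE; apply: eq_bigr => i _; rewrite mulrC.
rewrite dB (symdot w) x'w mulr0 subr0 symdot dB dwl -/a lerBlDr lerDl.
by rewrite mulrAC divr_ge0 ?ler0n // -expr2 sqr_ge0.
Qed.
End Mixing.

(** Ordered pairs are counted, so an edge inside [X :&: Y] counts twice. *)
Definition edges (T : finType) (e : rel T) (X Y : {set T}) : nat :=
  \sum_(x in X) #|[set y in Y | e x y]|.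

(** This is [real_mixing] for the characteristic vectors of [X] and [Y]. *)
Lemma expander_mixing (R : realType) (n d : nat) (lambda : R) (T : finType)
    (e : rel T) (X Y : {set T}) :
  ndl_graph n d lambda e -> lambda < d%:R ->
  ((edges e X Y)%:R - d%:R * #|X|%:R * #|Y|%:R / n%:R) ^+ 2
    <= lambda ^+ 2 * (#|X|%:R * #|Y|%:R).
Proof.
move=> [[sym irr] n_gt0 cT reg [s [[srt chr] hmax]]] lamd; subst n.
pose A := adjmx R e.
pose x (Z : {set T}) : 'rV[R]_#|T| := \row_i (enum_val i \in Z)%:R.
have sumx (Z : {set T}) (F : T -> R) :
    \sum_(i < #|T|) (enum_val i \in Z)%:R * F (enum_val i) = \sum_(z in Z) F z.
  rewrite -(big_enum_val (fun z => (z \in Z)%:R * F z)) /= big_mkcond /=.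
  rewrite [RHS]big_mkcond; apply: eq_bigr => z _.
  by case: (z \in Z); rewrite ?mul1r ?mul0r.
have sumx1 Z : \sum_i x Z 0 i = #|Z|%:R.
  rewrite -sumr_const -(sumx Z (fun=> 1)).
  by apply: eq_bigr => i _; rewrite mxE mulr1.
have dotx Z : (x Z *m (x Z)^T) 0 0 = #|Z|%:R.
  rewrite -sumx1 mxE; apply: eq_bigr => i _.
  by rewrite !mxE; case: (_ \in _); rewrite ?mulr1 ?mulr0.
have xAE (F : T -> R) : \row_i F (enum_val i) *m A = \row_j \sum_z F z * (e z (enum_val j))%:R.
  apply/rowP => j; rewrite !mxE; pose G z := F z * (e z (enum_val j))%:R.
  rewrite (eq_bigr (fun i => G (enum_val i))) => [|i _]; last by rewrite !mxE.
  by rewrite -big_enum_val.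
have regA : const_mx 1 *m A = d%:R *: const_mx 1 :> 'rV_#|T|.
  rewrite (_ : const_mx 1 = \row_i ((fun=> 1) (enum_val i) : R)); last first.
    by apply/rowP => i; rewrite !mxE.
  rewrite [LHS](xAE (fun=> 1)); apply/rowP => j; rewrite !mxE mulr1 -(reg (enum_val j)) -sumr_const.
  rewrite [RHS]big_mkcond /=; apply: eq_bigr => z _.
  by rewrite mul1r inE sym; case: (e _ _).
have symA : A^T = A by apply/matrixP => i j; rewrite !mxE sym.
have slam (j : nat) : (0 < j < #|T|)%N -> `|s`_j| <= lambda.
  move=> /andP[j0 jn]; move: hmax; rewrite ge_max => /andP[h1 h2].
  have hh (i k : nat) : (i <= k < #|T|)%N -> s`_k <= s`_i.
    move=> /andP[ik kn]; have tr : transitive (>=%R : rel R).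
      by move=> a b c ab bc; apply: le_trans bc ab.
    apply: (sorted_leq_nth tr (@lexx _ R) 0 srt) => //; rewrite inE size_tuple //.
    exact: leq_ltn_trans kn.
  have lj1 : s`_j <= s`_1 by apply: hh; rewrite j0 jn.
  have lnj : s`_#|T|.-1 <= s`_j by apply: hh; rewrite ltn_predL n_gt0 andbT -ltnS prednK.
  (* A nonnegative eigenvalue other than the first is bounded by the second, a negative one by the
     modulus of the last. *)
  case: (ger0P (s`_j)) => sj; first exact: le_trans h1.
  apply: le_trans h2; rewrite ltr0_norm; first by rewrite lerN2.
  exact: le_lt_trans lnj sj.
have lam0 : 0 <= lambda.
  by move: hmax; rewrite ge_max => /andP[_]; apply: le_trans; rewrite normr_ge0.
have := real_mixing n_gt0 symA chr lam0 slam lamd regA (x X) (x Y).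
rewrite !sumx1 !dotx; congr (_ <= _); congr ((_ - _) ^+ 2).
rewrite (xAE (fun z => (z \in X)%:R)) mxE /edges natr_sum.
rewrite (eq_bigr (fun j : 'I_#|T| =>
  (enum_val j \in Y)%:R * \sum_(z in X) (e z (enum_val j))%:R)); last first.
  move=> j _; rewrite !mxE mulrC; congr (_ * _); rewrite [RHS]big_mkcond.
  by apply: eq_bigr => z _; case: (z \in X); rewrite ?mul1r ?mul0r.
rewrite (sumx Y (fun y => \sum_(z in X) (e z y)%:R)) exchange_big /=.
apply: eq_bigr => z _; rewrite -sumr_const [RHS]big_mkcond [LHS]big_mkcond /=.
by apply: eq_bigr => y _; rewrite inE; case: (y \in Y); case: (e z y).
Qed.

(** * Packing connected dominating sets *)

Lemma within_mem (V : finType) (e : rel V) (F : {set V}) x y :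
  connect [rel u v in F | e u v] x y -> x \in F -> y \in F.
Proof.
case/connectP => p; elim: p x => [x _ -> //|z p IHp x /= /andP[/andP[/andP[_ zF] _] pz] yE _].
exact: IHp pz yE zF.
Qed.

Definition representatives (V : finType) (e : rel V) (F : {set V}) : {set V} :=
  [set z in F | fingraph.root [rel u v in F | e u v] z == z].

(** The neighbourhoods in [F] of distinct representatives lie in distinct components, hence the last
    bound. With a minimum degree inside [F] it limits the number of components. *)
Lemma representativesP (V : finType) (e : rel V) (F : {set V}) : symmetric e ->
  [/\ representatives e F \subset F,
    forall x, x \in F ->
      exists2 z, z \in representatives e F & connect [rel u v in F | e u v] z x &
    (\sum_(z in representatives e F) #|[set w in F | e z w]| <= #|F|)%N].
Proof.
move=> symE; rewrite /representatives; set r := [rel u v in F | e u v].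
have csym : connect_sym r := within_sym symE F.
split.
- by apply/subsetP => z; rewrite inE => /andP[].
- move=> x xF; exists (fingraph.root r x); last by rewrite csym connect_root.
  by rewrite inE (within_mem (connect_root r x)) //= root_root.
- rewrite -[leqRHS]sum1_card.
  rewrite [leqRHS](partition_big (fingraph.root r) (mem [set z in F | fingraph.root r z == z])) /=.
    apply: leq_sum => z; rewrite inE => /andP[zF /eqP rz].
    rewrite -sum1dep_card [leqLHS]big_mkcond [leqRHS]big_mkcond; apply: leq_sum => w _.
    case: ifP => // /andP[wF zw]; rewrite wF /=.
    have -> // : fingraph.root r w == z.
    by rewrite -[X in _ == X]rz root_connect // csym; apply: connect1; rewrite /= zF wF.
  move=> x xF; rewrite inE (within_mem (connect_root r x)) //= root_root //.
Qed.

(** * Expansion into the reserve *)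

Section MixingConsequences.
Variables (R : realType) (V : finType) (e : rel V) (d : nat) (lam kap : R).
Local Notation n := (#|V|%:R : R).
Hypotheses (d_gt0 : (0 < d)%N) (lam0 : 0 <= lam) (lamk : lam <= kap * d%:R).
Hypothesis mix : forall X Y : {set V},
  ((edges e X Y)%:R - d%:R * #|X|%:R * #|Y|%:R / n) ^+ 2 <= lam ^+ 2 * (#|X|%:R * #|Y|%:R).

Let d0 : 0 < d%:R :> R. Proof. by rewrite ltr0n. Qed.

(** With [a = #|X| * #|Y|] and no edges, mixing reads [(d * a / n) ^ 2 <= lam ^ 2 * a], and [a]
    cancels. *)
Lemma no_edges_small (X Y : {set V}) :
  (forall x y, x \in X -> y \in Y -> ~~ e x y) -> #|X|%:R * #|Y|%:R <= kap ^+ 2 * n ^+ 2.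
Proof.
move=> none; have := mix X Y.
have -> : edges e X Y = 0%N.
  rewrite /edges big1 // => x xX; apply: eq_card0 => y; rewrite !inE.
  by case yY: (y \in Y) => //=; apply/negbTE/none.
set a := #|X|%:R * #|Y|%:R; rewrite sub0r sqrrN -(mulrA d%:R) -/a => h.
have a0 : 0 <= a by rewrite mulr_ge0.
case: (eqVneq a 0) => [->|an0]; first by rewrite mulr_ge0 ?sqr_ge0.
have {an0}a0 : 0 < a by rewrite lt_def an0.
have n0 : 0 < n.
  rewrite ltr0n; apply/card_gt0P; move: a0; rewrite /a; case: (set_0Vmem X) => [->|[x _]].
    by rewrite cards0 mul0r ltxx.
  by exists x.
have h2 : (d%:R * a / n) ^+ 2 <= (kap * d%:R) ^+ 2 * a.
  apply: le_trans h _; rewrite ler_pM2r // lerXn2r ?nnegrE //.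
  exact: le_trans lamk.
rewrite -ler_pdivrMr ?exprn_gt0 // -(ler_pM2r a0) -(ler_pM2l (exprn_gt0 2 d0)).
apply: le_trans (le_trans h2 _); rewrite le_eqVlt; apply/orP; left; apply/eqP.
  by field; rewrite gt_eqF.
by rewrite exprMn; ring.
Qed.

Variables (Rs : {set V}) (rho : R) (D m W : nat).
Hypothesis rho0 : 0 < rho.
Hypothesis degR : forall v, rho * d%:R <= #|[set w in Rs | e v w]|%:R.
Hypotheses (symE : symmetric e) (reg : regular e d) (D_gt1 : (1 < D)%N).
Hypothesis kapD : kap ^+ 2 <= rho ^+ 2 / (32 * D%:R).
Hypothesis mE : m = Num.truncn (rho * n / (8 * D%:R)).
Hypothesis WE : W%:R <= rho * n / 4.
Hypothesis n_gt0 : (0 < #|V|)%N.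

Let n0 : 0 < n. Proof. by rewrite ltr0n. Qed.
Let D0 : 0 < D%:R :> R. Proof. by rewrite ltr0n ltnW. Qed.

Lemma reserve_large : rho * n <= #|Rs|%:R.
Proof.
rewrite -(ler_pM2r d0); have : (\sum_v #|[set w in Rs | e v w]| = #|Rs| * d)%N.
  rewrite -sum_nat_const (eq_bigr (fun v => \sum_(w in Rs) (e v w : nat))%N); last first.
    move=> v _; rewrite -sum1dep_card big_mkcondr; apply: eq_bigr => w _.
    by case: (e v w).
  rewrite exchange_big /=; apply: eq_bigr => w _; rewrite -(reg w) -sum1dep_card [RHS]big_mkcond.
  by apply: eq_bigr => v _; rewrite symE; case: (e w v).
rewrite -natrM => <-; rewrite natr_sum mulrAC -[n]sumr_const mulr_sumr.
by apply: ler_sum => v _; rewrite mulr1.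
Qed.

Let m_bnd : m%:R <= rho * n / (8 * D%:R) < m%:R + 1.
Proof.
by rewrite mE natr1; apply: truncn_itv; rewrite divr_ge0 ?mulr_ge0 // ltW.
Qed.

(** No edge joins [X] to the rest [Y] of the reserve, so [#|Y|] is at most [rho * n / 4]. The same
    bound holds for [W] and for [D * #|X|], while the reserve has at least [rho * n] vertices. *)
Lemma reserve_expand (X : {set V}) : (m < #|X| <= 2 * m)%N -> (W + D * #|X| < #|nbrs_in e Rs X|)%N.
Proof.
move=> /andP[mX X2]; rewrite -(ltr_nat R) natrD natrM.
set Y := Rs :\: nbrs_in e Rs X.
have XY : #|X|%:R * #|Y|%:R <= kap ^+ 2 * n ^+ 2.
  apply: no_edges_small => x y xX; rewrite in_setD => /andP[yn yR].
  apply: contra yn => xy; rewrite inE yR; apply/exists_inP; by exists x.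
have cR : #|Rs|%:R = #|nbrs_in e Rs X|%:R + #|Y|%:R :> R.
  rewrite -natrD -(cardsID (nbrs_in e Rs X) Rs) (setIidPr _) //.
  by apply/subsetP => r; rewrite inE => /andP[].
have [m1 m2] := andP m_bnd.
have Xge : rho * n / (8 * D%:R) < #|X|%:R.
  by apply: lt_le_trans m2 _; rewrite natr1 ler_nat.
have Xle : D%:R * #|X|%:R <= rho * n / 4.
  apply: le_trans (_ : D%:R * (2 * (rho * n / (8 * D%:R))) <= _).
    rewrite ler_pM2l //; apply: le_trans (_ : (2 * m)%:R <= _); first by rewrite ler_nat.
    by rewrite natrM ler_pM2l.
  by rewrite le_eqVlt; apply/orP; left; apply/eqP; field; rewrite gt_eqF.
have Yle : #|Y|%:R <= rho * n / 4.
  have p0 : 0 < rho * n / (8 * D%:R) by rewrite divr_gt0 ?mulr_gt0.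
  rewrite -(ler_pM2l p0); apply: le_trans (ler_wpM2r _ (ltW Xge)) _ => //.
  apply: le_trans XY _; apply: le_trans (ler_wpM2r _ kapD) _; first by rewrite sqr_ge0.
  by rewrite le_eqVlt; apply/orP; left; apply/eqP; field; rewrite gt_eqF.
have := reserve_large; rewrite cR; have : 0 < rho * n by rewrite mulr_gt0.
by move: WE; lra.
Qed.

(** If [X] reached too few vertices [Y], all its edges into the reserve, at least [rho * d * #|X|],
    would end in [Y]. Mixing predicts at most a quarter of that, and the excess contradicts
    [kapD]. *)
Lemma reserve_extendable : extendable e Rs D m [ffun=> None].
Proof.
split=> [r x|X X2]; first by rewrite ffunE.
set Y := nbrs_in e Rs X.
have -> : reach e Rs [ffun=> None] X = Y.
  by apply/setP => r; rewrite !inE ffunE.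
rewrite leqNgt; apply/negP => Ylt.
have X0 : 0 < #|X|%:R :> R.
  by rewrite ltr0n lt0n; apply: contraTneq Ylt => ->; rewrite muln0.
have [m1 m2] := andP m_bnd.
have {Ylt}Yle : #|Y|%:R <= D%:R * #|X|%:R :> R by rewrite -natrM ler_nat ltnW.
have Yn : #|Y|%:R <= rho * n / 4.
  apply: le_trans Yle _; apply: le_trans (_ : D%:R * (2 * (rho * n / (8 * D%:R))) <= _).
    rewrite ler_pM2l //; apply: le_trans (_ : (2 * m)%:R <= _); first by rewrite ler_nat.
    by rewrite natrM ler_pM2l.
  by rewrite le_eqVlt; apply/orP; left; apply/eqP; field; rewrite gt_eqF.
have eXY : rho * d%:R * #|X|%:R <= (edges e X Y)%:R.
  rewrite /edges natr_sum -[#|X|%:R]sumr_const mulr_sumr; apply: ler_sum => x xX.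
  rewrite mulr1; apply: le_trans (degR x) _; rewrite ler_nat; apply/subset_leq_card/subsetP => w.
  rewrite !inE => /andP[-> xw]; rewrite xw !andbT /=; apply/exists_inP; by exists x.
have eb : rho * d%:R * #|X|%:R * (3 / 4) <= (edges e X Y)%:R - d%:R * #|X|%:R * #|Y|%:R / n.
  have : d%:R * #|X|%:R * #|Y|%:R / n <= d%:R * #|X|%:R * (rho / 4).
    rewrite -mulrA ler_pM2l ?mulr_gt0 // ler_pdivrMr //.
    by move: Yn; rewrite mulrAC.
  by move: eXY; lra.
have p0 : 0 < rho * d%:R * #|X|%:R * (3 / 4) by rewrite !mulr_gt0 ?invr_gt0.
have h1 : (rho * d%:R * #|X|%:R * (3 / 4)) ^+ 2 <= lam ^+ 2 * (#|X|%:R * #|Y|%:R).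
  by apply: le_trans (mix X Y); rewrite lerXn2r ?nnegrE ?(ltW p0) // (le_trans (ltW p0)).
have h2 : lam ^+ 2 * (#|X|%:R * #|Y|%:R) <= (kap * d%:R) ^+ 2 * (#|X|%:R * (D%:R * #|X|%:R)).
  by rewrite ler_pM ?sqr_ge0 ?mulr_ge0 // ?ler_pM2l // lerXn2r ?nnegrE // (le_trans lam0).
have h3 : (kap * d%:R) ^+ 2 * (#|X|%:R * (D%:R * #|X|%:R))
    <= rho ^+ 2 / (32 * D%:R) * d%:R ^+ 2 * (#|X|%:R * (D%:R * #|X|%:R)).
  by rewrite ler_pM2r ?mulr_gt0 // exprMn ler_pM2r ?exprn_gt0.
have := le_trans h1 (le_trans h2 h3).
have -> : rho ^+ 2 / (32 * D%:R) * d%:R ^+ 2 * (#|X|%:R * (D%:R * #|X|%:R))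
   = (rho * d%:R * #|X|%:R) ^+ 2 / 32 by field; rewrite gt_eqF.
have : 0 < (rho * d%:R * #|X|%:R) ^+ 2 by rewrite exprn_gt0 ?mulr_gt0.
rewrite exprMn; lra.
Qed.

Lemma joined_large (N : nat) : kap * n < N%:R -> 0 <= kap -> joined e N.
Proof.
move=> Nk kap0 X Y XN YN.
have [/exists_inP[x xX /exists_inP[y yY xy]]|no] := boolP [exists x in X, [exists y in Y, e x y]].
  by exists x, y.
have : #|X|%:R * #|Y|%:R <= kap ^+ 2 * n ^+ 2.
  apply: no_edges_small => x y xX yY; apply: contra no => xy.
  by apply/exists_inP; exists x => //; apply/exists_inP; exists y.
rewrite -exprMn leNgt; case/negP; rewrite expr2.
have k0 : 0 <= kap * n by rewrite mulr_ge0.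
by apply: ltr_pM => //; apply: lt_le_trans Nk _; rewrite ler_nat.
Qed.
End MixingConsequences.

(** * Total length of the connecting paths *)

Lemma ln_le_subr1 (R : realType) (x : R) : 0 < x -> ln x <= x - 1.
Proof.
move=> x0; have := expR_ge1Dx (ln x); rewrite lnK ?posrE //; lra.
Qed.

(* x (ln (n / x) + 1) has derivative ln (n / x). *)
Lemma sum_ln_le (R : realType) (n N : nat) : (0 < N <= n)%N ->
  \sum_(2 <= c < N.+1) ln (n%:R / c%:R) <= N%:R * (ln (n%:R / N%:R) + 1) :> R.
Proof.
case: N => // N; elim: N => [|N IHN] /andP[_ Nn].
  rewrite big_geq // mul1r addr_ge0 // ln_ge0 // divr1 ler1n //.
have n0 : 0 < n%:R :> R by rewrite ltr0n (leq_trans _ Nn).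
rewrite big_nat_recr //=; apply: le_trans (lerD (IHN _) (lexx _)) _; first exact: ltnW.
set a : R := N.+1%:R; have a0 : 0 < a by rewrite ltr0n.
have -> : N.+2%:R = a + 1 :> R by rewrite natr1.
have a1 : 0 < a + 1 by rewrite addr_gt0.
rewrite !ln_div ?posrE //.
have h : ln (a + 1) - ln a <= a^-1.
  rewrite -ln_div ?posrE //; apply: le_trans (ln_le_subr1 _) _; first by rewrite divr_gt0.
  by rewrite mulrDl divff ?gt_eqF // mul1r addrAC subrr add0r.
have : a * (ln (a + 1) - ln a) <= 1.
  by rewrite -[leRHS](mulfV (lt0r_neq0 a0)) ler_pM2l.
lra.
Qed.

(** The bound [ln (n / (N * dd)) <= n / (N * dd) - 1] replaces [N * ln (n / N)] by an expression
    linear in [N], which can be summed over the classes. *)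
Lemma cost_le (R : realType) (depth : nat -> nat) (n N : nat) (lD dd : R) :
  0 < lD -> 1 <= dd ->
  (forall c, (1 < c <= n)%N -> (depth c)%:R <= ln (n%:R / c%:R) / lD + 1) ->
  (N <= n)%N ->
  (cost depth N)%:R <= 2 * ((N%:R * ln dd + n%:R / dd) / lD + N%:R) :> R.
Proof.
move=> lD0 dd1 hd Nn; have dd0 : 0 < dd by apply: lt_le_trans dd1.
case: N Nn => [|N] Nn.
  by rewrite /cost big_geq // mul0r add0r addr0 mulr_ge0 // !divr_ge0 // ltW.
have n0 : 0 < n%:R :> R by rewrite ltr0n (leq_trans _ Nn).
set a : R := N.+1%:R; have a0 : 0 < a by rewrite ltr0n.
rewrite /cost -big_distrr natrM ler_pM2l // natr_sum.
apply: le_trans (_ : \sum_(2 <= c < N.+2) (ln (n%:R / c%:R) / lD + 1) <= _).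
  by rewrite !big_nat; apply: ler_sum => c /andP[c2 cN]; apply: hd; rewrite c2 (leq_trans _ Nn).
rewrite big_split /= -mulr_suml sumr_const_nat lerD //; last first.
  by rewrite ler_nat subSS leq_subr.
rewrite ler_pM2r ?invr_gt0 //; apply: le_trans (sum_ln_le R _) _; first by [].
rewrite -/a.
have : ln (n%:R / (a * dd)) <= n%:R / (a * dd) - 1.
  by apply: ln_le_subr1; rewrite divr_gt0 // mulr_gt0.
rewrite !ln_div ?posrE ?mulr_gt0 // lnM ?posrE // => h.
have := ler_wpM2l (ltW a0) h.
have -> : a * (n%:R / (a * dd) - 1) = n%:R / dd - a.
  by rewrite mulrBr mulr1 invfM mulrCA mulVKf ?gt_eqF.
lra.
Qed.

Lemma trunc_log_le_ln (R : realType) (D x : nat) : (1 < D)%N -> (0 < x)%N ->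
  (trunc_log D x)%:R * ln D%:R <= ln x%:R :> R.
Proof.
move=> D1 x0; have Dp : 0 < D%:R :> R by rewrite ltr0n ltnW.
have h : D%:R ^+ trunc_log D x <= x%:R :> R by rewrite -natrX ler_nat trunc_logP.
rewrite mulr_natl -lnXn // ler_ln ?posrE //; first by rewrite exprn_gt0.
by rewrite ltr0n.
Qed.

(** * Depths and budgets *)

Section Packing.
Variables (R : realType) (V : finType) (e : rel V) (d k D c0 : nat).
Variables (lam kap rho mu g : R) (h : V -> nat).
Local Notation n := (#|V|%:R : R).
Local Notation cls i := [set x | h x == i].
Hypotheses (symE : symmetric e) (reg : regular e d) (d_gt0 : (0 < d)%N) (n_gt0 : (0 < #|V|)%N).
Hypotheses (lam0 : 0 <= lam) (kap0 : 0 <= kap) (lamk : lam <= kap * d%:R).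
Hypothesis mix : forall X Y : {set V},
  ((edges e X Y)%:R - d%:R * #|X|%:R * #|Y|%:R / n) ^+ 2 <= lam ^+ 2 * (#|X|%:R * #|Y|%:R).
Hypotheses (rho0 : 0 < rho) (mu0 : 0 < mu) (kd : (k <= d)%N).
Hypothesis degD : forall v i, (i < k)%N -> mu <= #|[set w | e v w && (h w == i)]|%:R.
Hypothesis degR : forall v, rho * d%:R <= #|[set w | e v w && (h w == k)]|%:R.
Hypotheses (D_gt1 : (1 < D)%N) (c0_gt0 : (0 < c0)%N).
Hypothesis kapD : kap ^+ 2 <= rho ^+ 2 / (32 * D%:R).
Hypothesis kapc : kap * c0%:R <= 1.
Hypothesis c0D : 64 * D%:R <= rho * c0%:R.
Hypothesis n_big : 16 * (4 * D%:R + 1) <= rho * n.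
Hypothesis mu_big : 64 <= rho * mu.
Hypothesis g_mu : ln d%:R <= mu * g.
Hypothesis D_big : 64 * (g + 1) <= rho * ln D%:R.

Let n0 : 0 < n. Proof. by rewrite ltr0n. Qed.
Let D0 : 0 < D%:R :> R. Proof. by rewrite ltr0n ltnW. Qed.

(** [D ^ depth c] exceeds [#|V| / maxn c c0]. The cap [c0] keeps the trees small against the
    reserve; for [c < c0] their leaf sets, larger than [kap * n], are joined by an edge. *)
Let depth (c : nat) : nat := (trunc_log D (#|V| %/ maxn c c0)).+1.
Let m := Num.truncn (rho * n / (8 * D%:R)).
(** The paths kept use at most [U] vertices; the gap up to [W] is room for two trees under
    construction. *)
Let W := Num.truncn (rho * n / 4).
Let U := Num.truncn (rho * n / 8).
Let Z i := representatives e (cls i).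

Let rn0 : 0 < rho * n. Proof. by rewrite mulr_gt0. Qed.

Let W_bnd : W%:R <= rho * n / 4 < W%:R + 1.
Proof. by rewrite natr1; apply: truncn_itv; rewrite divr_ge0 // ltW. Qed.

Let U_bnd : U%:R <= rho * n / 8 < U%:R + 1.
Proof. by rewrite natr1; apply: truncn_itv; rewrite divr_ge0 // ltW. Qed.

Let m_gt0 : (0 < m)%N.
Proof.
rewrite -(ltr_nat R) ltr0n; rewrite lt0n; apply/eqP => m0.
have : 0 <= rho * n / (8 * D%:R) by rewrite divr_ge0 ?mulr_ge0 // ltW.
move/truncn_itv => /andP[_]; rewrite -/m m0 ltr_pdivrMr ?mulr_gt0 // mul1r.
by have : 1 <= D%:R :> R by [rewrite ler1n ltnW]; move: n_big; lra.
Qed.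

Let depth_ok c : (1 < c)%N ->
  [/\ (0 < depth c)%N, (U + 4 * D ^ depth c <= W)%N &
      (#|V| < D ^ depth c * c)%N \/ joined e (D ^ depth c)].
Proof.
move=> c1; have c00 : 0 < c0%:R :> R by rewrite ltr0n.
have mx : (0 < maxn c c0)%N by rewrite leq_max c0_gt0 orbT.
have up : (#|V| < D ^ depth c * maxn c c0)%N by rewrite -ltn_divLR // trunc_log_ltn.
split=> //.
  rewrite -ltnS -(ltr_nat R) -natr1 natrD natrM.
  have Dle : (D ^ depth c)%:R <= D%:R * (n / c0%:R + 1).
    rewrite expnS natrM ler_pM2l //.
    (* If [maxn c c0] exceeds [#|V|], the quotient is [0], its logarithm is [0] by convention and
       the depth is [1]. *)
    case: (posnP (#|V| %/ maxn c c0)) => [->|x0].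
      by rewrite trunc_log0 expn0 lerDr divr_ge0 // ltW.
    apply: le_trans (_ : (#|V| %/ maxn c c0)%:R <= _); first by rewrite ler_nat trunc_logP.
    apply: le_trans (_ : n / c0%:R <= _); last by rewrite lerDl.
    rewrite ler_pdivlMr // -natrM ler_nat; apply: leq_trans (leq_trunc_div #|V| (maxn c c0)).
    by rewrite leq_mul2l leq_maxr orbT.
  have : D%:R * (n / c0%:R) <= rho * n / 64.
    rewrite mulrA ler_pdivrMr // mulrAC ler_pdivlMr // mulrAC [D%:R * _]mulrC.
    by have := ler_wpM2r (ltW n0) c0D; lra.
  by case/andP: U_bnd; case/andP: W_bnd; move: n_big Dle; lra.
case: (leqP c0 c) => cc; [left | right].
  by move: up; rewrite (maxn_idPl cc).
apply: (joined_large d_gt0 lam0 lamk mix) => //.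
rewrite -(ltr_pM2r c00); apply: le_lt_trans (_ : n < _).
  by rewrite mulrAC ler_piMl // ltW.
by rewrite -natrM ltr_nat; move: up; rewrite (maxn_idPr (ltnW cc)).
Qed.

Let depth_le c : (1 < c <= #|V|)%N -> (depth c)%:R <= ln (n / c%:R) / ln D%:R + 1.
Proof.
move=> /andP[c1 cn]; have c00 : 0 < c%:R :> R by rewrite ltr0n ltnW.
have lD : 0 < ln D%:R :> R by rewrite ln_gt0 // ltr1n.
rewrite -natr1 lerD2r ler_pdivlMr //.
case: (posnP (#|V| %/ maxn c c0)) => [->|x0].
  by rewrite trunc_log0 mul0r ln_ge0 // ler_pdivlMr // mul1r ler_nat.
apply: le_trans (trunc_log_le_ln R D_gt1 x0) _; rewrite ler_ln ?posrE ?ltr0n ?divr_gt0 //.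
rewrite ler_pdivlMr // -natrM ler_nat; apply: leq_trans (leq_trunc_div #|V| (maxn c c0)).
by rewrite leq_mul2l leq_maxl orbT.
Qed.

Let card_Z i : (i < k)%N -> #|Z i|%:R * mu <= #|cls i|%:R.
Proof.
move=> ik; have [_ _ hZ] := representativesP (cls i) symE.
apply: le_trans (_ : (\sum_(z in Z i) #|[set w in cls i | e z w]|)%:R <= _); last by rewrite ler_nat.
rewrite natr_sum mulr_natl -sumr_const; apply: ler_sum => z _.
apply: le_trans (degD z ik) _; rewrite ler_nat subset_leq_card //.
by apply/subsetP => w; rewrite !inE andbC.
Qed.

Let sum_cls : \sum_(i < k) #|cls i|%:R <= n.
Proof.
rewrite -natr_sum ler_nat (eq_bigr (fun i : 'I_k => \sum_x (h x == i))%N); last first.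
  by move=> i _; rewrite -sum1dep_card big_mkcond; apply: eq_bigr => x _; case: ifP.
rewrite exchange_big /= -sum1_card; apply: leq_sum => x _.
case: (ltnP (h x) k) => [hk|kh].
  rewrite (bigD1 (Ordinal hk)) //= eqxx big1 ?addn0 // => i; rewrite -val_eqE /= eq_sym.
  by move/negbTE->.
rewrite big1 // => i _; apply/eqP; rewrite eqb0; apply: contraTneq (ltn_ord i) => <-.
by rewrite -leqNgt.
Qed.

(** All classes together have [S <= n / mu] components, so [S * ln d <= g * n], and [k <= d] bounds
    the other term by [n]. Division by [ln D] makes both small against [rho * n]. *)
Let total_cost : (\sum_(i < k) cost depth #|Z i| <= U)%N.
Proof.
have lD : 0 < ln D%:R :> R by rewrite ln_gt0 // ltr1n.
have d0 : 0 < d%:R :> R by rewrite ltr0n.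
have d1 : 1 <= d%:R :> R by rewrite ler1n.
have ld0 : 0 <= ln d%:R :> R by rewrite ln_ge0.
rewrite -ltnS -(ltr_nat R) -natr1 natr_sum.
set S : R := \sum_(i < k) #|Z i|%:R.
have S0 : 0 <= S by apply: sumr_ge0.
have Smu : S * mu <= n.
  apply: le_trans sum_cls; rewrite /S mulr_suml; apply: ler_sum => i _; exact: card_Z.
have h1 : \sum_(i < k) (cost depth #|Z i|)%:R
    <= 2 * ((S * ln d%:R + k%:R * (n / d%:R)) / ln D%:R + S).
  apply: le_trans (_ : \sum_(i < k) 2 * ((#|Z i|%:R * ln d%:R + n / d%:R) / ln D%:R + #|Z i|%:R) <= _).
    by apply: ler_sum => i _; apply: cost_le => //; rewrite max_card.
  rewrite -mulr_sumr big_split /= -mulr_suml big_split /= -mulr_suml sumr_const card_ord.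
  by rewrite -[_ *+ k]mulr_natl.
have h2 : S * ln d%:R <= n * g.
  apply: le_trans (ler_wpM2l S0 g_mu) _; rewrite mulrA ler_wpM2r //.
  rewrite -(pmulr_rge0 _ mu0); exact: le_trans g_mu.
have h3 : k%:R * (n / d%:R) <= n.
  by rewrite mulrA ler_pdivrMr // mulrC ler_pM2l // ler_nat.
have h4 : (S * ln d%:R + k%:R * (n / d%:R)) / ln D%:R <= rho * n / 64.
  rewrite ler_pdivrMr //; apply: le_trans (lerD h2 h3) _.
  by have := ler_wpM2l (ltW n0) D_big; lra.
have h5 : S <= rho * n / 64.
  have := ler_wpM2l S0 mu_big; have := ler_wpM2l (ltW rho0) Smu; lra.
by case/andP: U_bnd; move: n_big; have : 1 <= D%:R :> R by [rewrite ler1n ltnW]; lra.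
Qed.

Lemma connected_packing :
  exists F : nat -> {set V},
   [/\ forall i, (i < k)%N -> cls i \subset F i,
       forall i, (i < k)%N -> connected_set e (F i) &
       forall i j, (i < k)%N -> (j < k)%N -> i != j -> [disjoint F i & F j]].
Proof.
have degR' v : rho * d%:R <= #|[set w in cls k | e v w]|%:R.
  apply: le_trans (degR v) _; rewrite ler_nat subset_leq_card //.
  by apply/subsetP => w; rewrite !inE andbC.
have WE : W%:R <= rho * n / 4 by case/andP: W_bnd.
have dis i j : i != j -> [disjoint cls i & cls j].
  move=> ij; rewrite -setI_eq0; apply/eqP/setP => x; rewrite !inE.
  by case: eqP => // ->; apply/negbTE.
have hZ i := representativesP (cls i) symE.
apply: (connect_all m_gt0 D_gt1 _ symE depth_ok (R := cls k) (Zm := Z)) => //.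
- exact: (reserve_expand d_gt0 lam0 lamk mix rho0 degR' symE reg D_gt1 kapD erefl WE n_gt0).
- exact: (reserve_extendable d_gt0 lam0 lamk mix rho0 degR' D_gt1 kapD erefl n_gt0).
- by move=> i ik; apply: dis; rewrite ltn_eqF.
- by move=> i j _ _; apply: dis.
- move=> i r ik _; have : 0 < #|[set w | e r w && (h w == i)]|%:R :> R.
    exact: lt_le_trans (degD r ik).
  rewrite ltr0n => /card_gt0P[y]; rewrite inE => /andP[ry hy].
  by exists y; rewrite ?inE.
- by move=> i _; have [] := hZ i.
- by move=> i x _; have [_ + _] := hZ i; apply.
Qed.
End Packing.

(** * Choice of the constants and conclusion *)

(** If [n <= 2 * d], mixing a vertex with itself gives [lam >= 1 / 2]. Otherwise mixing it with its
    neighbourhood, where at most [d / 2] edges are predicted instead of [d], gives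
    [d <= 4 * lam ^ 2]. *)
Lemma degree_large (R : realType) (n d : nat) (lam C : R) (T : finType) (e : rel T) :
  ndl_graph n d lam e -> 2 <= C -> 0 < lam -> C * lam < d%:R -> C / 2 <= d%:R.
Proof.
move=> G C2 lam0 Cd; have [[symE irr] n0 cT reg _] := G.
have d0 : 0 < d%:R :> R by apply: lt_trans Cd; rewrite mulr_gt0 //; lra.
have lamd : lam < d%:R by apply: le_lt_trans Cd; rewrite ler_peMl ?(ltW lam0) //; lra.
have mix X Y := expander_mixing X Y G lamd.
have n0' : 0 < n%:R :> R by rewrite ltr0n.
have /card_gt0P[v _] : (0 < #|T|)%N by rewrite cT.
have [nd|nd] := lerP n%:R (2 * d%:R : R).
  have := mix [set v] [set v]; rewrite cards1 !mulr1.
  have -> : edges e [set v] [set v] = 0%N.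
    rewrite /edges big_set1; apply: eq_card0 => w; rewrite !inE.
    by case: eqP => // ->; rewrite irr.
  rewrite sub0r sqrrN ler_sqr ?nnegrE ?divr_ge0 ?(ltW d0) ?(ltW n0') ?(ltW lam0) //.
  rewrite ler_pdivrMr // => dl.
  have l2 : 1 <= lam * 2.
    rewrite -(ler_pM2r d0) mul1r; apply: le_trans dl _; rewrite -mulrA ler_pM2l //.
  by nra.
have := mix [set v] [set w | e v w]; rewrite cards1 mulr1 mul1r reg.
have -> : edges e [set v] [set w | e v w] = d.
  rewrite /edges big_set1 -(reg v); apply: eq_card => w; rewrite !inE.
  by rewrite andbb.
move=> h; have h1 : d%:R * d%:R / n%:R <= d%:R / 2 :> R.
  by rewrite ler_pdivrMr //; nra.
have h2 : (d%:R / 2) ^+ 2 <= lam ^+ 2 * d%:R.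
  by apply: le_trans h; rewrite lerXn2r ?nnegrE //; lra.
have h3 : d%:R <= 4 * lam ^+ 2.
  by rewrite -(ler_pM2r d0); lra.
have h4 : (C * lam) ^+ 2 < d%:R ^+ 2.
  have p : 0 <= C * lam by rewrite mulr_ge0 ?(ltW lam0) //; lra.
  by rewrite !expr2 ltr_pM.
have h5 : C ^+ 2 * d%:R < 4 * d%:R * d%:R.
  apply: le_lt_trans (_ : C ^+ 2 * (4 * lam ^+ 2) < _).
    by rewrite ler_wpM2l // sqr_ge0.
  by move: h4; rewrite exprMn expr2; lra.
move: h5; rewrite ltr_pM2r // expr2 => h5; nra.
Qed.

Theorem theorem1p2 (R : realType) (eps : R) (heps : 0 < eps) :
  exists C : R,
    forall (n d : nat) (lambda : R) (T : finType) (e : rel T),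
      ndl_graph n d lambda e ->
      d%:R / lambda > C ->
      exists P : {set {set T}},
        [/\ forall S : {set T}, S \in P -> connected_dominating e S,
            trivIset P &
            (1 - eps) * (d%:R / ln d%:R) <= #|P|%:R].
Proof.
(* The estimates need [ep <= 1 / 2], and a smaller [eps] gives a stronger conclusion. *)
pose ep := Num.min eps 2^-1.
have ep0 : 0 < ep by rewrite lt_min heps invr_gt0 ltr0n.
have ep1 : ep <= 2^-1 by rewrite ge_min lexx orbT.
have epe : ep <= eps by rewrite ge_min lexx.
(* [rho] is the reserve density from [domatic_colouring], and [g] is the ratio of [ln d] to the
   class degree. They determine [D], which with [rho] determines [c0]. *)
pose rho := ep / 32; pose g := 64 / ep ^+ 2.
have rho0 : 0 < rho by rewrite divr_gt0.
have ep2 : 0 < ep ^+ 2 by rewrite exprn_gt0.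
have ep3 : 0 < ep ^+ 3 by rewrite exprn_gt0.
have g0 : 0 < g by rewrite divr_gt0.
have natP (x : R) : 0 <= x -> exists k : nat, x <= k.+1%:R.
  by move=> /truncn_itv/andP[_ /ltW]; exists (Num.truncn x).
have [D' D'P] : exists D' : nat, expR (64 * (g + 1) / rho) <= D'.+1%:R by apply/natP/expR_ge0.
pose D := D'.+2.
have DP : 64 * (g + 1) <= rho * ln D%:R.
  rewrite [leRHS]mulrC -ler_pdivrMr // -[leLHS]expRK ler_ln ?posrE ?expR_gt0 ?ltr0n //.
  by apply: le_trans D'P _; rewrite ler_nat.
have D0 : 0 < D%:R :> R by rewrite ltr0n.
have [c' c'P] : exists c' : nat, 64 * D%:R / rho <= c'.+1%:R.
  by apply: natP; apply: divr_ge0; [apply: mulr_ge0; rewrite ?(ltW D0) | exact: ltW].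
pose c0 := c'.+1.
pose L0 := 64 * 64 * 160 / ep ^+ 3.
(* [t1] makes [ln d] and [t2] makes [n >= d] large, doubled because only [d >= C / 2] is known. With
   [kap = 1 / C], [t3] gives [kap * c0 <= 1] and [t4] bounds [kap ^ 2]. *)
pose t1 := 2 * expR L0; pose t2 := 2 * (16 * (4 * D%:R + 1) / rho).
pose t3 : R := c0%:R; pose t4 := 32 * D%:R / rho ^+ 2.
have t10 : 0 < t1 by rewrite mulr_gt0 ?expR_gt0.
have t20 : 0 < t2 by rewrite mulr_gt0 // divr_gt0 // mulr_gt0 // addr_gt0 // mulr_gt0.
have t30 : 0 < t3 by rewrite ltr0n.
have t40 : 0 < t4 by apply: divr_gt0; [exact: mulr_gt0 | exact: exprn_gt0].
exists (2 + t1 + t2 + t3 + t4); set C := _ + _ => n d lam T e G Cd.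
have C2 : 2 <= C by rewrite /C; lra.
have C0 : 0 < C by lra.
(* For [lam <= 0] the quotient is at most [0], the inverse of [0] being [0] by convention. *)
have lam0 : 0 < lam.
  rewrite ltNge; apply/negP => l0; move: Cd; rewrite ltNge => /negP; apply.
  by apply: le_trans (ltW C0); rewrite mulr_ge0_le0 // invr_le0.
have Cd' : C * lam < d%:R by rewrite -ltr_pdivlMr.
have dC := degree_large G C2 lam0 Cd'.
have d0 : 0 < d%:R :> R by lra.
have lamd : lam < d%:R by apply: le_lt_trans Cd'; rewrite ler_peMl ?(ltW lam0) //; lra.
have [[symE irr] n0 cT reg _] := G.
have nd : (d <= #|T|)%N.
  have /card_gt0P[v _] : (0 < #|T|)%N by rewrite cT.
  by rewrite -(reg v) max_card.
pose L := ln d%:R : R.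
have LL0 : L0 <= L.
  rewrite -[leLHS]expRK ler_ln ?posrE ?expR_gt0 //.
  by move: dC; rewrite /C /t1; lra.
have Lbig : 64 * 64 * 160 <= L * ep ^+ 3 by rewrite -ler_pdivrMr.
have [k [h [kge kd hD hR]]] := domatic_colouring ep0 ep1 symE reg Lbig.
have LP : 0 < L by rewrite -(pmulr_lgt0 _ ep3); lra.
pose mu := ep ^+ 2 / 64 * L.
have mu0 : 0 < mu by rewrite mulr_gt0 // divr_gt0.
pose kap := C^-1.
have [F [DF conF disF]] : exists F : nat -> {set T},
   [/\ forall i, (i < k)%N -> [set x | h x == i] \subset F i,
       forall i, (i < k)%N -> connected_set e (F i) &
       forall i j, (i < k)%N -> (j < k)%N -> i != j -> [disjoint F i & F j]].
  apply: (@connected_packing R T e d k D c0 lam kap rho mu g h) => //.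
  - by rewrite -(ltr_nat R).
  - by rewrite cT.
  - exact: ltW.
  - by rewrite invr_ge0 ltW.
  - by rewrite mulrC ler_pdivlMr // mulrC ltW.
  - by move=> X Y; rewrite cT; apply: expander_mixing G lamd.
  - rewrite /kap exprVn -[leRHS]invrK lef_pV2 ?posrE ?invr_gt0 ?exprn_gt0 //; last first.
      by apply: divr_gt0; [exact: exprn_gt0 | exact: mulr_gt0].
    rewrite invf_div -/t4; apply: le_trans (_ : C * 1 <= _).
      by rewrite mulr1 /C; lra.
    by rewrite expr2 ler_pM2l //; lra.
  - rewrite mulrC /kap ler_pdivrMr // mul1r -/t3 /C; lra.
  - by rewrite [leRHS]mulrC -ler_pdivrMr.
  - rewrite [leRHS]mulrC -ler_pdivrMr //.
    apply: le_trans (_ : d%:R <= _); last by rewrite ler_nat.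
    by move: dC; rewrite /C /t2; lra.
  - rewrite /rho /mu; have -> : ep / 32 * (ep ^+ 2 / 64 * L) = L * ep ^+ 3 / 2048 by field.
    lra.
  - rewrite /mu /g -/L; have -> : ep ^+ 2 / 64 * L * (64 / ep ^+ 2) = L by field; rewrite gt_eqF.
    exact: lexx.
have domF i x : (i < k)%N -> exists2 y, y \in F i & e x y.
  move=> ik; have : 0 < #|[set w | e x w && (h w == i)]|%:R :> R.
    exact: lt_le_trans mu0 (hD x i ik).
  rewrite ltr0n => /card_gt0P[y]; rewrite inE => /andP[xy hy].
  by exists y => //; apply: (subsetP (DF i ik)); rewrite inE.
have /card_gt0P[v0 _] : (0 < #|T|)%N by rewrite cT.
(* Two equal sets with different indices would be disjoint, hence empty, but a dominating set is
   not. *)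
have injF : injective (fun i : 'I_k => F i).
  move=> i j Fij; apply/eqP; apply: contraT => ij.
  have := disF i j (ltn_ord i) (ltn_ord j) ij; rewrite Fij -setI_eq0 setIid => /eqP F0.
  by have [y] := domF j v0 (ltn_ord j); rewrite F0 inE.
exists [set F i | i : 'I_k]; split.
- move=> S /imsetP[i _ ->]; split; last exact: conF.
  by move=> x; right; exact: domF.
- apply/trivIsetP => A B /imsetP[i _ ->] /imsetP[j _ ->] AB.
  by apply: disF => //; apply: contraNneq AB => /val_inj->.
- rewrite card_imset // card_ord; apply: le_trans kge; rewrite ler_wpM2r //.
    by rewrite divr_ge0 // ltW.
  by move: epe; lra.
Qed.
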